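(* Let $X\subseteq\mathbb{R}^n$ be r.e. open. (a ii) Fix a $(\nu\to\rho^n)$-computable sequence $(\vec x_j)_{j}$ whose set of values is dense in $X$. A function $f:X\to\mathbb{R}^m$ is computable if and only if the real sequence $(f(\vec x_j))_j$ is computable and there is a $(\rho^n\times\nu\rightrightarrows\nu)$-computable multi-valued function $\mathrm{moc}:X\times\mathbb{N}\rightrightarrows\mathbb{N}$ such that $f[B(\vec x,2^{-\ell})\cap X]\subseteq B(f(\vec x),2^{-k})$ for all $\vec x\in X$, $k\in\mathbb{N}$, $\ell\in\mathrm{moc}(\vec x,k)$. (b i) A computable $f:X\to\mathbb{R}^m$ is effectively open if and only if $\mathrm{Moo}_f:X\times\mathbb{N}\to\mathbb{R}$ is strictly positive and $(\rho^n\times\nu\to\rho_<)$-computable. (b ii) Equivalently, a computable $f:X\to\mathbb{R}^m$ is effectively open if and only if there is a $(\rho^n\times\nu\rightrightarrows\nu)$-computable multi-valued function $\mathrm{moo}:X\times\mathbb{N}\rightrightarrows\mathbb{N}$ such that $B(f(\vec x),2^{-\ell})\subseteq f[B(\vec x,2^{-k})\cap X]$ for all $\vec x\in X$, $k\in\mathbb{N}$, $\ell\in\mathrm{moo}(\vec x,k)$.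
   Context: Computability is in the sense of Type-2 Theory of Effectivity (Weihrauch). $\nu$ is the standard notation of $\mathbb{N}$; $\rho^n$ is the Cauchy representation of $\mathbb{R}^n$ (a name is a sequence of rational vectors $\vec q_k$ with $|\vec q_k-\vec x|<2^{-k}$); $\rho_<$ is the representation of $\mathbb{R}$ by sequences of rationals converging from below (lower approximations). $\theta^d_<$ is the representation of open subsets of $\mathbb{R}^d$: a name of $U$ is a list of rational centers and positive rational radii of open Euclidean balls whose union is $U$. $X\subseteq\mathbb{R}^n$ is r.e. open if it has a computable $\theta^n_<$-name. An open function $f:X\to\mathbb{R}^m$ is effectively open if the mapping $U\mapsto f[U]$ on open $U\subseteq X$ is $(\theta^n_<\to\theta^m_<)$-computable. A multi-valued function $h:A\rightrightarrows B$ is $(\delta\rightrightarrows\delta')$-computable if some Type-2 machine, on any $\delta$-name of any $a\in\operatorname{dom}$, outputs a $\delta'$-name of some element of $h(a)$ (the element may depend on the name). $B(\vec x,r)$ is the open Euclidean ball. $\mathrm{Moo}_f(\vec x,k):=\sup\{s\ge0:\overline{B}(f(\vec x),s)\subseteq f[B(\vec x,2^{-k})\cap X]\}$, where $\overline{B}$ denotes the closed ball.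
   Formalization: Moo_f may be infinite (e.g. f(x)=tan(πx) on (-1/2,1/2), k=0), so it is taken with values in the extended reals, and ρ_< is extended so that sequences of rationals unbounded above name +∞; on finite values nothing changes. *)

(* Defs.v *)
From HB Require Import structures.
From mathcomp Require Import all_boot all_order all_algebra.
From mathcomp Require Import all_classical all_reals.
From mathcomp Require Import ereal Rstruct.

Set Implicit Arguments.
Unset Strict Implicit.
Unset Printing Implicit Defensive.
Import Order.TTheory GRing.Theory Num.Theory.
Local Open Scope ring_scope.
Local Open Scope classical_set_scope.

Notation R := Rdefinitions.R.

(* A Type-2 computable (multi-)function on Baire space is one whose    *)
(* output sequence q is obtained as q k = Phi^p(k) for an oracle       *)
(* mu-recursive Phi with the input name p as oracle (this is the       *)
(* standard equivalent of Weihrauch's Type-2 machines).                *)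

Inductive prf : Type :=
| PZero
| PSucc
| PProj of nat
| POrc
| PComp of prf & list prf
| PRec of prf & prf
| PMu of prf.

Fixpoint eval (fuel : nat) (p : nat -> nat) (e : prf) (args : seq nat)
  : option nat :=
  match fuel with
  | 0 => None
  | k.+1 =>
    match e with
    | PZero => Some 0
    | PSucc => Some (head 0 args).+1
    | PProj i => Some (nth 0 args i)
    | POrc => Some (p (head 0 args))
    | PComp f gs =>
        let fix evs (l : list prf) : option (seq nat) :=
          match l with
          | nil => Some nil
          | g :: l' =>
              match eval k p g args, evs l' with
              | Some v, Some vs => Some (v :: vs)
              | _, _ => None
              end
          end in
        match evs gs with
        | Some vs => eval k p f vs
        | None => None
        end
    | PRec f g =>
        let ys := behead args in
        let fix pr (x : nat) : option nat :=
          match x with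
          | 0 => eval k p f ys
          | x'.+1 =>
              match pr x' with
              | Some r => eval k p g (x' :: r :: ys)
              | None => None
              end
          end in
        pr (head 0 args)
    | PMu f =>
        let fix mu (y c : nat) : option nat :=
          match c with
          | 0 => None
          | c'.+1 =>
              match eval k p f (y :: args) with
              | Some 0 => Some y
              | Some _ => mu y.+1 c'
              | None => None
              end
          end in
        mu 0 k
    end
  end.

Definition computes (p : nat -> nat) (e : prf) (args : seq nat) (v : nat) :=
  exists fuel, eval fuel p e args = Some v.

Definition realizes (e : prf) (p q : nat -> nat) :=
  forall k, computes p e [:: k] (q k).

Definition computable_name (q : nat -> nat) :=
  exists e, realizes e (fun _ => 0%N) q.

Definition rep (A : Type) := (nat -> nat) -> A -> Prop.

Definition mv_computable (A B : Type) (dA : rep A) (dB : rep B)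
    (D : set A) (h : A -> B -> Prop) :=
  exists e : prf, forall (a : A) (p : nat -> nat), D a -> dA p a ->
    exists q, realizes e p q /\ exists b, h a b /\ dB q b.

Definition fun_computable (A B : Type) (dA : rep A) (dB : rep B)
    (D : set A) (f : A -> B) :=
  mv_computable dA dB D (fun a b => b = f a).

Definition prod_rep (A B : Type) (dA : rep A) (dB : rep B) : rep (A * B) :=
  fun r ab => dA (fun i => r (2 * i)%N) ab.1 /\ dB (fun i => r (2 * i).+1) ab.2.

Definition nu : rep nat := fun p k => p 0%N = k.

Definition decQ (k : nat) : rat := odflt 0 (unpickle k).
Definition decV (d : nat) (k : nat) : 'rV[rat]_d := odflt 0 (unpickle k).
Definition decB (d : nat) (k : nat) : 'rV[rat]_d * rat :=
  odflt (0, 0) (unpickle k).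

Definition vratr (d : nat) (v : 'rV[rat]_d) : 'rV[R]_d := map_mx ratr v.

Definition enorm (d : nat) (v : 'rV[R]_d) : R :=
  Num.sqrt (\sum_(i < d) v 0 i ^+ 2).
Definition eball (d : nat) (c : 'rV[R]_d) (r : R) : set 'rV[R]_d :=
  [set y | enorm (y - c) < r].
Definition ecball (d : nat) (c : 'rV[R]_d) (r : R) : set 'rV[R]_d :=
  [set y | enorm (y - c) <= r].

Definition eopen (d : nat) (U : set 'rV[R]_d) :=
  forall x, U x -> exists2 r : R, 0 < r & eball x r `<=` U.

Definition rho (d : nat) : rep 'rV[R]_d :=
  fun p x => forall k : nat, enorm (vratr (decV d (p k)) - x) < 2 ^- k.

(* lower representation: x is the supremum of the listed rationals.
   It is stated in the extended reals, so that +oo is also named (by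
   sequences unbounded above); on finite values it is the usual rho_<. *)
Definition rho_lt : rep (\bar R) :=
  fun p y => ereal_sup (range (fun k => (ratr (decQ (p k)) : R)%:E)) = y.

Definition theta_lt (d : nat) : rep (set 'rV[R]_d) :=
  fun p U => U = \bigcup_(k in [set: nat])
                   eball (vratr (decB d (p k)).1) (ratr (decB d (p k)).2).

Definition re_open (d : nat) (X : set 'rV[R]_d) :=
  exists p, computable_name p /\ theta_lt p X.

Definition computable_on (n m : nat) (X : set 'rV[R]_n)
    (f : 'rV[R]_n -> 'rV[R]_m) :=
  fun_computable (@rho n) (@rho m) X f.

Definition computable_seq (d : nat) (s : nat -> 'rV[R]_d) :=
  fun_computable nu (@rho d) [set: nat] s.

Definition dense_seq_in (d : nat) (s : nat -> 'rV[R]_d) (X : set 'rV[R]_d) :=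
  (forall j, X (s j)) /\
  (forall x, X x -> forall eps : R, 0 < eps -> exists j, enorm (s j - x) < eps).

Definition eff_open (n m : nat) (X : set 'rV[R]_n)
    (f : 'rV[R]_n -> 'rV[R]_m) :=
  fun_computable (@theta_lt n) (@theta_lt m) [set U | eopen U /\ U `<=` X]
                 (fun U => f @` U).

Definition Moo (n m : nat) (X : set 'rV[R]_n) (f : 'rV[R]_n -> 'rV[R]_m)
    (x : 'rV[R]_n) (k : nat) : \bar R :=
  ereal_sup [set s%:E | s in [set s : R | 0 <= s /\
              ecball (f x) s `<=` f @` (eball x (2 ^- k) `&` X)]].

(* Main.v *)
(** Finite oracle approximations carry the argument.  For a fixed machine [e],
    running [e] on a finite prefix of a name is a total function of the (code
    of the) prefix, and it is itself computable by recursion on [e]; a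
    converging run on a prefix is valid for every name extending that prefix.
    Every machine needed below is therefore a search for, or an enumeration of,
    tuples that pass a decidable test about finite runs and rational
    inequalities.
    - (a ii) A converging run of [f] on a prefix of length [N] of a name of [x]
      gives the same output for all points close to [x], which is a modulus of
      continuity.  Conversely, a modulus at [x] tells how close [xs j] has to be
      to [x] for [f (xs j)] to be a good approximation of [f x].
    - (b) goes round the cycle: effectively open, [Moo] positive and lower
      computable, [moo] computable, effectively open.  For the first step one
      must recognise that a closed ball lies in a union of open balls that is
      only enumerated: by compactness this is witnessed by finitely many of
      the balls and a fine enough rational grid.  For the last step, [f @` U] is
      the union of the balls [B(f x, 2^-l)] over rational [x] and outputs [l]
      of [moo] on names of [x] that start with an arbitrary prefix; a
      real point of [U] is reached because [moo] uses only a prefix of its name. *)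

Require Import Defs.
From HB Require Import structures.
From mathcomp Require Import all_boot all_order all_algebra.
From mathcomp Require Import all_classical all_reals.
From mathcomp Require Import ereal Rstruct.
From mathcomp Require Import topology normedtype ring lra.
Import Order.TTheory GRing.Theory Num.Theory.
Import numFieldNormedType.Exports.
Import CodeSeq.

Set Implicit Arguments.
Unset Strict Implicit.
Unset Printing Implicit Defensive.

Local Notation eval := Defs.eval.

Local Open Scope nat_scope.

(** No machine is programmed with explicit dovetailing. A candidate is one number coding a list of
    data together with all the run lengths involved, and checking it is a total computable test. Two
    shapes of machine then suffice. For [rho] and [nu], where every entry that is read must be
    right, the machine searches for a passing candidate. For [theta_lt] and [rho_lt], where only the
    union or the supremum counts, entry [j] is what candidate [j] proposes, or a neutral value if
    its check fails. The obstacle with multi-valued moduli is that the answer may differ between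
    names of the same point. Each use ties the answer to one name, and determinism of runs
    identifies the value seen by the check with the value that the modulus guarantees. Rationals,
    vectors and balls are coded by the generic [pickle], so decoding has to be shown recursive
    before any rational test counts as computable. *)

Section PrfInd.
Variable P : prf -> Prop.
Hypotheses (P0 : P PZero) (P1 : P PSucc) (P2 : forall i, P (PProj i)) (P3 : P POrc).
Hypothesis P4 : forall f gs, P f -> List.Forall P gs -> P (PComp f gs).
Hypotheses (P5 : forall f g, P f -> P g -> P (PRec f g)) (P6 : forall f, P f -> P (PMu f)).
(** The generated principle gives no hypothesis for the list inside [PComp]. *)
Fixpoint prf_nested_ind (e : prf) : P e :=
  match e with
  | PZero => P0 | PSucc => P1 | PProj i => P2 i | POrc => P3
  | PComp f gs => P4 (prf_nested_ind f)
      ((fix F l : List.Forall P l := match l with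
        | nil => List.Forall_nil P
        | g :: l' => List.Forall_cons g (prf_nested_ind g) (F l') end) gs)
  | PRec f g => P5 (prf_nested_ind f) (prf_nested_ind g)
  | PMu f => P6 (prf_nested_ind f)
  end.
End PrfInd.

(** * Runs on finite oracles *)

(** This and the next two functions name the anonymous inner fixpoints of [eval], so that lemmas can
    be stated about them and [ev] can share them. *)
Fixpoint oseq (A : Type) (s : seq (option A)) : option (seq A) :=
  match s with
  | nil => Some nil
  | x :: s' => match x, oseq s' with
               | Some v, Some vs => Some (v :: vs) | _, _ => None end
  end.

Definition rec_opt (f : option nat) (g : nat -> nat -> option nat) :=
  fix pr (x : nat) : option nat :=
    match x with
    | 0 => f
    | x'.+1 => match pr x' with Some r => g x' r | None => None end
    end.

Definition mu_opt (f : nat -> option nat) :=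
  fix mu (y c : nat) : option nat :=
    match c with
    | 0 => None
    | c'.+1 => match f y with
               | Some 0 => Some y | Some _ => mu y.+1 c' | None => None end
    end.

Lemma eval_comp k p f gs a : eval k.+1 p (PComp f gs) a =
  obind (eval k p f) (oseq [seq eval k p g a | g <- gs]).
Proof.
rewrite /=; set s := _ gs; have -> : s = oseq [seq eval k p g a | g <- gs].
  by rewrite /s; elim: gs {s} => //= g gs ->.
by case: oseq.
Qed.

Lemma eval_rec k p f g a : eval k.+1 p (PRec f g) a =
  rec_opt (eval k p f (behead a))
    (fun x r => eval k p g (x :: r :: behead a)) (head 0 a).
Proof. by []. Qed.

Lemma eval_mu k p f a : eval k.+1 p (PMu f) a =
  mu_opt (fun y => eval k p f (y :: a)) 0 k.
Proof. by []. Qed.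

Lemma oseq_mono (T A : Type) (f g : T -> option A) (s : seq T) vs :
  List.Forall (fun x => forall v, f x = Some v -> g x = Some v) s ->
  oseq [seq f x | x <- s] = Some vs -> oseq [seq g x | x <- s] = Some vs.
Proof.
move=> H; elim: H vs => //= x s' Hx _ IH vs.
case E: (f x) => [v|] //; case E': (oseq _) => [w|] // [<-].
by rewrite (Hx _ E) (IH _ E').
Qed.

Lemma rec_opt_mono f f' g g' x v :
  (forall v, f = Some v -> f' = Some v) ->
  (forall x r v, g x r = Some v -> g' x r = Some v) ->
  rec_opt f g x = Some v -> rec_opt f' g' x = Some v.
Proof.
move=> Hf Hg; elim: x v => [|x IH] v /=; first exact: Hf.
by case E: rec_opt => [r|] // /Hg; rewrite (IH _ E).
Qed.

Lemma mu_opt_mono f g y c c' v :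
  (forall y v, f y = Some v -> g y = Some v) -> c <= c' ->
  mu_opt f y c = Some v -> mu_opt g y c' = Some v.
Proof.
move=> H; elim: c c' y => [|c IH] [|c'] y //= le_c.
by case E: (f y) => [[|w]|] //; rewrite (H _ _ E) //; apply: IH.
Qed.

Lemma Forall_all (A : Type) (P : A -> Prop) (s : seq A) :
  (forall x, P x) -> List.Forall P s.
Proof. by move=> H; elim: s => *; constructor. Qed.

Lemma eval_mono k k' p e a v : k <= k' ->
  eval k p e a = Some v -> eval k' p e a = Some v.
Proof.
elim: k k' e a v => [|k IH] [|k'] e a v // le_k.
have IH' := fun e a v => IH k' e a v le_k.
case: e => [||i||f gs|f g|f] //.
- rewrite !eval_comp; case E: oseq => [vs|] // /IH' /=.
  suff -> : oseq [seq eval k' p g a | g <- gs] = Some vs by [].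
  by apply: oseq_mono E; apply: Forall_all => g; apply: IH'.
- by rewrite !eval_rec; apply: rec_opt_mono => *; apply: IH'.
- by rewrite !eval_mu; apply: mu_opt_mono => // *; apply: IH'.
Qed.

Lemma computes_fun p e a v w : computes p e a v -> computes p e a w -> v = w.
Proof.
case=> k1 E1 [k2 E2].
have := eval_mono (leq_maxl k1 k2) E1.
by rewrite (eval_mono (leq_maxr k1 k2) E2) => -[].
Qed.

Lemma computes_comp p f gs a vs v :
  List.Forall2 (fun g w => computes p g a w) gs vs -> computes p f vs v ->
  computes p (PComp f gs) a v.
Proof.
move=> Hgs [k0 E0].
have [k1 E1] : exists k, oseq [seq eval k p g a | g <- gs] = Some vs.
  elim: Hgs => [|g w gs' ws [k E] _ [k' E']] /=; first by exists 0.
  exists (maxn k k'); rewrite (eval_mono (leq_maxl k k') E).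
  have -> // : oseq [seq eval (maxn k k') p g a | g <- gs'] = Some ws.
  by apply: oseq_mono E'; apply: Forall_all => h u; apply/eval_mono/leq_maxr.
exists (maxn k0 k1).+1; rewrite eval_comp.
have -> : oseq [seq eval (maxn k0 k1) p g a | g <- gs] = Some vs.
  by apply: oseq_mono E1; apply: Forall_all => h u; apply/eval_mono/leq_maxr.
exact: eval_mono (leq_maxl _ _) E0.
Qed.

Lemma computes_rec p f g a (h : nat -> nat) :
  computes p f (behead a) (h 0) ->
  (forall x, computes p g (x :: h x :: behead a) (h x.+1)) ->
  computes p (PRec f g) a (h (head 0 a)).
Proof.
move=> [k0 E0] Hg; set x := head 0 a.
suff [k E] : exists k, rec_opt (eval k p f (behead a))
    (fun x r => eval k p g (x :: r :: behead a)) x = Some (h x).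
  by exists k.+1; rewrite eval_rec.
elim: x => [|x [k E]]; first by exists k0.
have [k' E'] := Hg x; exists (maxn k k') => /=.
rewrite (rec_opt_mono _ _ E); first exact: eval_mono (leq_maxr _ _) E'.
- by move=> v; apply/eval_mono/leq_maxl.
- by move=> y r v; apply/eval_mono/leq_maxl.
Qed.

Lemma computes_mu p f a (h : nat -> nat) n :
  (forall y, y <= n -> computes p f (y :: a) (h y)) ->
  h n = 0 -> (forall y, y < n -> h y != 0) ->
  computes p (PMu f) a n.
Proof.
move=> Hf hn0 hn.
have {Hf}[k Hk] : exists k, forall y, y <= n -> eval k p f (y :: a) = Some (h y).
  elim: n Hf {hn0 hn} => [|n IH] Hf.
    by have [k E] := Hf 0 (leqnn _); exists k => -[].
  have [k Hk] := IH (fun y le => Hf y (leqW le)).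
  have [k' Hk'] := Hf n.+1 (leqnn _); exists (maxn k k') => y.
  rewrite leq_eqVlt => /orP[/eqP->|lt]; first exact: eval_mono (leq_maxr _ _) Hk'.
  exact: eval_mono (leq_maxl _ _) (Hk y lt).
(* The fuel of a [PMu] node also bounds the number of values tried, here [n.+1]. *)
exists (maxn k n.+1).+1; rewrite eval_mu.
have {}Hk y : y <= n -> eval (maxn k n.+1) p f (y :: a) = Some (h y).
  by move=> le; apply: eval_mono (leq_maxl _ _) (Hk _ le).
have := leq_maxr k n.+1; set K := maxn _ _ in Hk *.
rewrite -{1}(subn0 n).
suff H c y : y <= n -> n - y < c ->
    mu_opt (fun y => eval K p f (y :: a)) y c = Some n by apply: H.
elim: c y => // c IH y le_y lt_c /=; rewrite Hk //.
have [eq_y|lt_y] := leqP n y.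
  by have -> : y = n by [apply/eqP; rewrite eqn_leq le_y]; rewrite hn0.
case: (h y) (hn _ lt_y) => // w _; apply: IH => //; rewrite ltnS in lt_c.
by apply: leq_trans lt_c; rewrite subnS prednK // subn_gt0.
Qed.

(* [ev s e a] runs [e] with the finite sequence [s] as oracle: queries beyond
   [size s] diverge, and unbounded searches stop at [size s]. *)
Fixpoint ev (s : seq nat) (e : prf) (a : seq nat) {struct e} : option nat :=
  match e with
  | PZero => Some 0
  | PSucc => Some (head 0 a).+1
  | PProj i => Some (nth 0 a i)
  | POrc => if head 0 a < size s then Some (nth 0 s (head 0 a)) else None
  | PComp f gs => obind (ev s f) (oseq [seq ev s g a | g <- gs])
  | PRec f g => rec_opt (ev s f (behead a))
                  (fun x r => ev s g (x :: r :: behead a)) (head 0 a)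
  | PMu f => mu_opt (fun y => ev s f (y :: a)) 0 (size s)
  end.

(** A converging run makes finitely many queries. Allowing every larger [N] lets several runs be put
    on a common prefix. *)
Lemma ev_complete p k e a v : eval k p e a = Some v ->
  exists N0, forall N, N0 <= N -> ev (mkseq p N) e a = Some v.
Proof.
elim: k e a v => [//|k IH] e a v.
case: e => [||i||f gs|f g|f].
- by exists 0.
- by exists 0.
- by exists 0.
- move=> [<-]; exists (head 0 a).+1 => N lt_N /=.
  by rewrite size_mkseq lt_N nth_mkseq.
- rewrite eval_comp; case E: oseq => [vs|] //= /IH[N0 H0].
  have [N1 H1] : exists N1, forall N, N1 <= N ->
      oseq [seq ev (mkseq p N) g a | g <- gs] = Some vs.
    elim: gs vs E {H0} => [|g gs IHg] vs /=; first by move=> [<-]; exists 0.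
    case E: (eval _ _ _ _) => [w|] //; case E': (oseq _) => [ws|] //= [<-].
    have [N1 H1] := IH _ _ _ E; have [N2 H2] := IHg _ E'.
    exists (maxn N1 N2) => N; rewrite geq_max => /andP[/H1-> /H2->] //.
  by exists (maxn N0 N1) => N; rewrite geq_max => /andP[/H0 h /H1 /= ->].
- rewrite eval_rec /=; elim: (head 0 a) v => [|x IHx] v /=; first exact: IH.
  case E: rec_opt => [r|] // /IH[N0 H0]; have [N1 H1] := IHx _ E.
  by exists (maxn N0 N1) => N; rewrite geq_max => /andP[/H0 h /H1 ->].
- rewrite eval_mu /=.
  suff H c y : mu_opt (fun y => eval k p f (y :: a)) y c = Some v ->
    exists N0, forall N, N0 <= N -> forall c', c <= c' ->
      mu_opt (fun y => ev (mkseq p N) f (y :: a)) y c' = Some v.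
    (* [ev] cuts searches at the length of the prefix, so this length must also reach the fuel
       [k]. *)
    move=> /H[N0 H0]; exists (maxn N0 k) => N; rewrite geq_max => /andP[h1 h2].
    by apply: H0; rewrite ?size_mkseq.
  elim: c y => //= c IHc y; case E: (eval _ _ _ _) => [[|w]|] //.
    move=> [<-]; have [N0 H0] := IH _ _ _ E.
    by exists N0 => N /H0 EN [|c'] //= _; rewrite EN.
  move=> /IHc[N1 H1]; have [N0 H0] := IH _ _ _ E.
  exists (maxn N0 N1) => N; rewrite geq_max => /andP[h0 h1] [|c'] //= le_c.
  by rewrite H0 // H1.
Qed.

Lemma computes_ev p e a v : computes p e a v ->
  exists N0, forall N, N0 <= N -> ev (mkseq p N) e a = Some v.
Proof. by case=> k /ev_complete. Qed.

Lemma ev_sound s p e a v : (forall i, i < size s -> p i = nth 0 s i) ->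
  ev s e a = Some v -> computes p e a v.
Proof.
move=> Hs; elim/prf_nested_ind: e a v => [||i||f gs IHf IHgs|f g IHf IHg|f IHf] a v /=.
- by move=> [<-]; exists 1.
- by move=> [<-]; exists 1.
- by move=> [<-]; exists 1.
- by case: ifP => // /Hs H [<-]; exists 1; rewrite /= H.
- case E: oseq => [vs|] //= /IHf; apply: computes_comp.
  elim: gs vs IHgs E => [|g gs IH] vs Hgs /=.
    by move=> [<-]; constructor.
  case E: (ev _ _ _) => [w|] //; case E': (oseq _) => [ws|] // [<-].
  have [Hg Hgs'] := (List.Forall_inv Hgs, List.Forall_inv_tail Hgs).
  by constructor; [apply: Hg|apply: IH].
- move=> E; suff [k Ek] : exists k, rec_opt (eval k p f (behead a))
      (fun x r => eval k p g (x :: r :: behead a)) (head 0 a) = Some v.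
    by exists k.+1; rewrite eval_rec.
  elim: (head 0 a) v E => [|x IH] v /=; first exact: IHf.
  case E: rec_opt => [r|] // /IHg[k' E']; have [k {}E] := IH _ E.
  exists (maxn k k'); rewrite (rec_opt_mono _ _ E).
  + exact: eval_mono (leq_maxr _ _) E'.
  + by move=> w; apply/eval_mono/leq_maxl.
  + by move=> y r' w; apply/eval_mono/leq_maxl.
- suff H c y : mu_opt (fun y => ev s f (y :: a)) y c = Some v ->
    exists k, mu_opt (fun y => eval k p f (y :: a)) y c = Some v.
    move=> /H[k E]; exists (maxn k (size s)).+1; rewrite eval_mu.
    apply: mu_opt_mono E => [z w|]; last exact: leq_maxr.
    exact/eval_mono/leq_maxl.
  elim: c y => //= c IH y; case E: (ev _ _ _) => [[|w]|] //.
    by move=> [<-]; have [k {}E] := IHf _ _ E; exists k; rewrite E.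
  move=> /IH[k' E']; have [k {}E] := IHf _ _ E.
  exists (maxn k k'); rewrite (eval_mono (leq_maxl _ _) E).
  by apply: mu_opt_mono E' => // z u; apply/eval_mono/leq_maxr.
Qed.

(** * Computable functionals *)

(* Only argument lists of the exact length [n] are considered, because
   composition in [prf] needs an explicit list of arguments. *)
Definition cpt (n : nat) (F : (nat -> nat) -> seq nat -> nat) :=
  exists e, forall p a, size a = n -> computes p e a (F p a).

(** Divergence becomes the value 0, which turns a partial run into a total function to which [cpt]
    applies. *)
Definition osucc (o : option nat) := if o is Some v then v.+1 else 0.

Fixpoint prec (z : nat) (s : nat -> nat -> nat) (n : nat) :=
  if n is n'.+1 then s n' (prec z s n') else z.

(** The environments met under nested recursions: every bound variable is pushed in front, so the
    outer arguments appear below some number of [behead]. *)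
Definition shift (T : seq nat -> seq nat) := exists k, forall a, T a = drop k a.

Lemma Forall_map (A B : Type) (Q : B -> Prop) (f : A -> B) (s : seq A) :
  (forall x, Q (f x)) -> List.Forall Q [seq f x | x <- s].
Proof. by move=> H; elim: s => [|x s IH] /=; [exact: List.Forall_nil|exact: List.Forall_cons]. Qed.

Section Closure.
Variable n : nat.
Implicit Types F G H : (nat -> nat) -> seq nat -> nat.

Lemma cpt_ext F G : (forall p a, size a = n -> F p a = G p a) -> cpt n F -> cpt n G.
Proof. by move=> E [e He]; exists e => p a sa; rewrite -E //; apply: He. Qed.

Lemma cpt_zero : cpt n (fun _ _ => 0).
Proof. by exists PZero => p a _; exists 1. Qed.

Lemma cpt_comp k H (Gs : seq ((nat -> nat) -> seq nat -> nat)) :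
  cpt k H -> size Gs = k -> List.Forall (cpt n) Gs ->
  cpt n (fun p a => H p [seq G p a | G <- Gs]).
Proof.
move=> [e He] sG HG.
have [es Hes] : exists es, forall p a, size a = n ->
    List.Forall2 (fun g w => computes p g a w) es [seq G p a | G <- Gs].
  elim: HG {sG} => [|G Gs' [g Hg] _ [es Hes]]; first by exists nil => *; constructor.
  by exists (g :: es) => p a sa /=; constructor; [apply: Hg|apply: Hes].
exists (PComp e es) => p a sa; apply: computes_comp (Hes p a sa) _.
by apply: He; rewrite size_map.
Qed.

Lemma cpt_succ F : cpt n F -> cpt n (fun p a => (F p a).+1).
Proof.
move=> HF; apply: (cpt_comp (k := 1) (H := fun _ b => (nth 0 b 0).+1) (Gs := [:: F])) => //.
  by exists PSucc => p a _; exists 1; rewrite /= -nth0.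
by do !constructor.
Qed.

Lemma cpt_const c : cpt n (fun _ _ => c).
Proof. by elim: c => [|c /cpt_succ]; first exact: cpt_zero. Qed.

Lemma cpt_orc F : cpt n F -> cpt n (fun p a => p (F p a)).
Proof.
move=> HF; apply: (cpt_comp (k := 1) (H := fun p b => p (nth 0 b 0)) (Gs := [:: F])) => //.
  by exists POrc => p a _; exists 1; rewrite /= -nth0.
by do !constructor.
Qed.

Lemma cpt_nth i : cpt n (fun _ a => nth 0 a i).
Proof. by exists (PProj i) => p a _; exists 1. Qed.

Lemma cpt_var T i : shift T -> cpt n (fun _ a => nth 0 (T a) i).
Proof.
move=> [k Hk]; apply: (cpt_ext (F := fun _ a => nth 0 a (k + i))); last exact: cpt_nth.
by move=> p a _; rewrite Hk nth_drop.
Qed.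

Lemma cpt_app1 (h : nat -> nat) F : cpt 1 (fun _ b => h (nth 0 b 0)) ->
  cpt n F -> cpt n (fun p a => h (F p a)).
Proof.
move=> Hh HF; apply: (cpt_comp (Gs := [:: F]) Hh) => //.
by do !constructor.
Qed.

Lemma cpt_app2 (h : nat -> nat -> nat) F G :
  cpt 2 (fun _ b => h (nth 0 b 0) (nth 0 b 1)) ->
  cpt n F -> cpt n G -> cpt n (fun p a => h (F p a) (G p a)).
Proof.
move=> Hh HF HG; apply: (cpt_comp (Gs := [:: F; G]) Hh) => //.
by do !constructor.
Qed.

Lemma cpt_prec Z (S : (nat -> nat) -> seq nat -> nat -> nat -> nat) N :
  cpt n Z ->
  cpt n.+2 (fun p a => S p (behead (behead a)) (nth 0 a 0) (nth 0 a 1)) ->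
  cpt n N -> cpt n (fun p a => prec (Z p a) (S p a) (N p a)).
Proof.
move=> [z Hz] [s Hs] HN.
have H : cpt n.+1
    (fun p a => prec (Z p (behead a)) (S p (behead a)) (head 0 a)).
  exists (PRec z s) => p [|x a] //= [sa].
  apply: (computes_rec (h := prec (Z p a) (S p a))) => [|y] /=; first exact: Hz.
  by have := Hs p [:: y, prec (Z p a) (S p a) y & a]; rewrite /= sa; apply.
(* [PRec] recurses on the head of its argument list, so it is fed [N] followed by a copy of all [n]
   arguments. *)
pose Gs := N :: [seq (fun _ a => nth 0 a i) | i <- iota 0 n].
have HGs : List.Forall (cpt n) Gs.
  by constructor=> //; apply: Forall_map => i; exact: cpt_nth.
have := cpt_comp H _ HGs; rewrite /= size_map size_iota.
move=> /(_ erefl); apply: cpt_ext => p a sa /=.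
by rewrite -map_comp /comp /= -sa -/(mkseq _ _) mkseq_nth.
Qed.

Lemma shift_id : shift id.
Proof. by exists 0 => a; rewrite drop0. Qed.

Lemma shift_behead T : shift T -> shift (fun a => behead (T a)).
Proof. by move=> [k Hk]; exists k.+1 => a; rewrite Hk -drop1 drop_drop. Qed.

End Closure.

Lemma cpt_behead n F : cpt n F -> cpt n.+1 (fun p a => F p (behead a)).
Proof.
pose Gs : seq ((nat -> nat) -> seq nat -> nat) :=
  [seq (fun _ a => nth 0 a i.+1) | i <- iota 0 n].
move=> HF; have HGs : List.Forall (cpt n.+1) Gs.
  by apply: Forall_map => i; exact: cpt_nth.
have := cpt_comp HF _ HGs; rewrite /= size_map size_iota.
move=> /(_ erefl); apply: cpt_ext => p [|x a] //= [sa].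
by rewrite -map_comp /comp /= -sa -/(mkseq _ _) mkseq_nth.
Qed.

Lemma cpt_behead2 n F : cpt n F -> cpt n.+2 (fun p a => F p (behead (behead a))).
Proof. by move=> /cpt_behead/cpt_behead. Qed.

Ltac cpt_base := lazymatch goal with
  | |- cpt _ (fun _ _ => ?k) => apply: cpt_const
  | |- cpt _ (fun p a => nth 0 (@?T a) ?i) =>
      apply: cpt_var; do ?apply: shift_behead; exact: shift_id
  | |- cpt _ (fun p a => (@?F p a).+1) => apply: cpt_succ
  | |- cpt _ (fun p a => p (@?F p a)) => apply: cpt_orc
  end.
(** A hook for [solve_cpt], redefined whenever further closure lemmas become available. *)
Ltac cpt_more := fail.
Ltac solve_cpt := repeat first [assumption | cpt_base | cpt_more].

Lemma cpt_add n F G : cpt n F -> cpt n G -> cpt n (fun p a => F p a + G p a).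
Proof.
apply: (cpt_app2 (h := addn)).
apply: (@cpt_ext _ (fun p b => prec (nth 0 b 0) (fun _ r => r.+1) (nth 0 b 1))).
  by move=> p b _; elim: (nth 0 b 1) => [|k /= ->]; rewrite ?addn0 ?addnS.
by apply: (@cpt_prec _ _ (fun _ _ _ r => r.+1)); solve_cpt.
Qed.

Lemma cpt_mul n F G : cpt n F -> cpt n G -> cpt n (fun p a => F p a * G p a).
Proof.
apply: (cpt_app2 (h := muln)).
apply: (@cpt_ext _ (fun p b => prec 0 (fun _ r => r + nth 0 b 0) (nth 0 b 1))).
  by move=> p b _; elim: (nth 0 b 1) => [|k /= ->]; rewrite ?muln0 ?mulnSr.
apply: (@cpt_prec _ _ (fun _ b _ r => r + nth 0 b 0)); solve_cpt.
by apply: cpt_add; solve_cpt.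
Qed.

Lemma cpt_expn n F G : cpt n F -> cpt n G -> cpt n (fun p a => F p a ^ G p a).
Proof.
apply: (cpt_app2 (h := expn)).
apply: (@cpt_ext _ (fun p b => prec 1 (fun _ r => r * nth 0 b 0) (nth 0 b 1))).
  by move=> p b _; elim: (nth 0 b 1) => [|k /= ->]; rewrite ?expn0 ?expnSr.
apply: (@cpt_prec _ _ (fun _ b _ r => r * nth 0 b 0)); solve_cpt.
by apply: cpt_mul; solve_cpt.
Qed.

Lemma cpt_pred n F : cpt n F -> cpt n (fun p a => (F p a).-1).
Proof.
apply: (cpt_app1 (h := predn)).
apply: (@cpt_ext _ (fun p b => prec 0 (fun i _ => i) (nth 0 b 0))).
  by move=> p b _; case: (nth 0 b 0).
by apply: (@cpt_prec _ _ (fun _ _ i _ => i)); solve_cpt.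
Qed.

Lemma cpt_sub n F G : cpt n F -> cpt n G -> cpt n (fun p a => F p a - G p a).
Proof.
apply: (cpt_app2 (h := subn)).
apply: (@cpt_ext _ (fun p b => prec (nth 0 b 0) (fun _ r => r.-1) (nth 0 b 1))).
  by move=> p b _; elim: (nth 0 b 1) => [|k /= ->]; rewrite ?subn0 ?subnS.
apply: (@cpt_prec _ _ (fun _ b _ r => r.-1)); solve_cpt.
by apply: cpt_pred; solve_cpt.
Qed.

Lemma cpt_double n F : cpt n F -> cpt n (fun p a => (F p a).*2).
Proof.
move=> HF; apply: (@cpt_ext _ (fun p a => F p a + F p a)); last exact: cpt_add.
by move=> p a _; rewrite addnn.
Qed.

Lemma cpt_eq0 n F : cpt n F -> cpt n (fun p a => F p a == 0).
Proof.
move=> HF; apply: (@cpt_ext _ (fun p a => 1 - F p a)).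
  by move=> p a _; case: (F p a).
by apply: cpt_sub; solve_cpt.
Qed.

Lemma cpt_leq n F G : cpt n F -> cpt n G -> cpt n (fun p a => F p a <= G p a).
Proof. by move=> HF HG; apply: cpt_eq0; apply: cpt_sub. Qed.

Lemma cpt_neg n (b : (nat -> nat) -> seq nat -> bool) : cpt n b -> cpt n (fun p a => ~~ b p a).
Proof.
move=> Hb; apply: (@cpt_ext _ (fun p a => 1 - b p a)).
  by move=> p a _; case: (b p a).
by apply: cpt_sub; solve_cpt.
Qed.

Lemma cpt_and n (b c : (nat -> nat) -> seq nat -> bool) :
  cpt n b -> cpt n c -> cpt n (fun p a => b p a && c p a).
Proof.
move=> Hb Hc; apply: (@cpt_ext _ (fun p a => b p a * c p a)).
  by move=> p a _; rewrite mulnb.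
exact: cpt_mul.
Qed.

Lemma cpt_or n (b c : (nat -> nat) -> seq nat -> bool) :
  cpt n b -> cpt n c -> cpt n (fun p a => b p a || c p a).
Proof.
move=> Hb Hc; apply: (@cpt_ext _ (fun p a => ~~ (~~ b p a && ~~ c p a))).
  by move=> p a _; rewrite negb_and !negbK.
by apply: cpt_neg; apply: cpt_and; apply: cpt_neg.
Qed.

Lemma cpt_eqn n F G : cpt n F -> cpt n G -> cpt n (fun p a => F p a == G p a).
Proof.
move=> HF HG; apply: (@cpt_ext _ (fun p a => (F p a <= G p a) && (G p a <= F p a))).
  by move=> p a _; rewrite -eqn_leq.
by apply: cpt_and; apply: cpt_leq.
Qed.

Lemma cpt_if n (b : (nat -> nat) -> seq nat -> bool) F G :
  cpt n b -> cpt n F -> cpt n G -> cpt n (fun p a => if b p a then F p a else G p a).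
Proof.
move=> Hb HF HG; apply: (@cpt_ext _ (fun p a => b p a * F p a + ~~ b p a * G p a)).
  by move=> p a _; case: (b p a); rewrite ?mul1n ?mul0n ?addn0.
by apply: cpt_add; apply: cpt_mul => //; apply: cpt_neg.
Qed.

Lemma cpt_odd n F : cpt n F -> cpt n (fun p a => odd (F p a)).
Proof.
apply: (cpt_app1 (h := odd)).
apply: (@cpt_ext _ (fun p b => prec 0 (fun i r => 1 - r) (nth 0 b 0))).
  by move=> p b _; elim: (nth 0 b 0) => //= k ->; case: odd.
by apply: (@cpt_prec _ _ (fun _ _ i r => 1 - r)); solve_cpt; apply: cpt_sub; solve_cpt.
Qed.

Lemma cpt_find n (P : (nat -> nat) -> seq nat -> nat -> bool) N :
  cpt n.+1 (fun p a => P p (behead a) (nth 0 a 0)) -> cpt n N ->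
  cpt n (fun p a => find (P p a) (iota 0 (N p a))).
Proof.
(* Invariant: after [i] rounds the state is the result of [find] on [iota 0 i], which is below [i]
   exactly when a hit has occurred. *)
move=> HP HN; apply: (@cpt_ext _ (fun p a =>
  prec 0 (fun i r => if r < i then r else if P p a i then r else r.+1) (N p a))).
  move=> p a _; elim: (N p a) => // k IH.
  rewrite -addn1 iotaD find_cat addn1 [LHS]/= IH size_iota add0n has_find size_iota.
  have := find_size (P p a) (iota 0 k); rewrite size_iota leq_eqVlt.
  case: ltnP => // le_k /orP[/eqP E|//].
  by rewrite /= E; case: (P p a k); rewrite ?addn0 ?addn1.
apply: (@cpt_prec _ _ (fun p a i r =>
  if r < i then r else if P p a i then r else r.+1)); solve_cpt.
apply: cpt_if; first by apply: cpt_leq; solve_cpt.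
  by solve_cpt.
apply: cpt_if; solve_cpt.
have [e He] := HP; pose Gs : seq ((nat -> nat) -> seq nat -> nat) :=
  [seq (fun _ a => nth 0 a (if i is i'.+1 then i'.+2 else 0)) | i <- iota 0 n.+1].
have HGs : List.Forall (cpt n.+2) Gs.
  by apply: Forall_map => i; exact: cpt_nth.
have := cpt_comp HP _ HGs; rewrite size_map size_iota => /(_ erefl).
apply: cpt_ext => p [|x [|y a]] //= [sa].
congr (nat_of_bool (P p _ _)); rewrite -map_comp /comp /= -sa.
by rewrite -[RHS](mkseq_nth 0) /mkseq (iotaDl 1 0) -map_comp; apply: eq_map.
Qed.

Lemma cpt_has n (P : (nat -> nat) -> seq nat -> nat -> bool) N :
  cpt n.+1 (fun p a => P p (behead a) (nth 0 a 0)) -> cpt n N ->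
  cpt n (fun p a => has (P p a) (iota 0 (N p a))).
Proof.
move=> HP HN; apply: (@cpt_ext _ (fun p a => find (P p a) (iota 0 (N p a)) < N p a)).
  by move=> p a _; rewrite has_find size_iota.
by apply: cpt_leq; [apply: cpt_succ; apply: cpt_find|].
Qed.

Lemma cpt_all n (P : (nat -> nat) -> seq nat -> nat -> bool) N :
  cpt n.+1 (fun p a => P p (behead a) (nth 0 a 0)) -> cpt n N ->
  cpt n (fun p a => all (P p a) (iota 0 (N p a))).
Proof.
move=> HP HN; apply: (@cpt_ext _ (fun p a =>
    ~~ has (fun i => ~~ P p a i) (iota 0 (N p a)))).
  by move=> p a _; rewrite -all_predC; congr nat_of_bool; apply: eq_all => i /=; rewrite negbK.
by apply: cpt_neg; apply: (@cpt_has _ (fun p a i => ~~ P p a i)) => //; apply: cpt_neg.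
Qed.

Ltac cpt_arith := lazymatch goal with
  | |- cpt _ (fun p a => @?F p a + @?G p a) => apply: cpt_add
  | |- cpt _ (fun p a => @?F p a * @?G p a) => apply: cpt_mul
  | |- cpt _ (fun p a => @?F p a ^ @?G p a) => apply: cpt_expn
  | |- cpt _ (fun p a => @?F p a - @?G p a) => apply: cpt_sub
  | |- cpt _ (fun p a => (@?F p a).-1) => apply: cpt_pred
  | |- cpt _ (fun p a => (@?F p a).*2) => apply: cpt_double
  | |- cpt _ (fun p a => nat_of_bool (@?F p a <= @?G p a)) => apply: cpt_leq
  | |- cpt _ (fun p a => nat_of_bool (@eq_op Datatypes_nat__canonical__eqtype_Equality
      (@?F p a) (@?G p a))) => apply: cpt_eqn
  | |- cpt _ (fun p a => nat_of_bool (~~ @?F p a)) => apply: cpt_neg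
  | |- cpt _ (fun p a => nat_of_bool (@?F p a && @?G p a)) => apply: cpt_and
  | |- cpt _ (fun p a => nat_of_bool (@?F p a || @?G p a)) => apply: cpt_or
  | |- cpt _ (fun p a => nat_of_bool (odd (@?F p a))) => apply: cpt_odd
  (* The function is applied to dummy arguments just to see whether its body is a conditional. *)
  | |- cpt _ ?f => let t := eval cbv beta in (f (fun i => i) nil) in
      lazymatch t with (if _ then _ else _) => apply: cpt_if end
  end.

Ltac cpt_more ::= cpt_arith.

(** * Computability of list operations, with lists coded as numbers *)

Lemma cpt_cons n F (L : (nat -> nat) -> seq nat -> seq nat) :
  cpt n F -> cpt n (fun p a => code (L p a)) ->
  cpt n (fun p a => code (F p a :: L p a)).
Proof. by move=> HF HL; rewrite /=; solve_cpt. Qed.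

Lemma code_gt x s : code s < code (x :: s) /\ x < code (x :: s).
Proof.
have := ltn_code (x :: s) => /=/andP[h _]; split=> //.
rewrite -[(code s).+1]mul1n leq_mul ?expn_gt0 // ltnS -addnn leq_addr //.
Qed.

Lemma code_inj : injective code.
Proof. exact: can_inj codeK. Qed.

Lemma find_iota (P : pred nat) N x : x < N -> P x -> (forall y, P y -> y = x) ->
  find P (iota 0 N) = x.
Proof.
move=> ltx Px uP; have hP : has P (iota 0 N).
  by apply/hasP; exists x => //; rewrite mem_iota.
have := nth_find 0 hP; rewrite nth_iota; first by rewrite add0n => /uP.
by rewrite -[X in _ < X](size_iota 0 N) -has_find.
Qed.

(** Since [code (x :: s)] is [2 ^ x * (code s).*2.+1], bounded search recovers both parts: each is
    below the code by [code_gt], and injectivity of [code] makes them unique. *)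
Lemma cpt_head n (L : (nat -> nat) -> seq nat -> seq nat) :
  cpt n (fun p a => code (L p a)) -> cpt n (fun p a => head 0 (L p a)).
Proof.
pose h c := if c == 0 then 0 else
  find (fun x => has (fun m => 2 ^ x * m.*2.+1 == c) (iota 0 c)) (iota 0 c).
move=> HL; apply: (@cpt_ext _ (fun p a => h (code (L p a)))).
  move=> p a _; rewrite /h; case: (L p a) => [|x s] //.
  have [lt_s lt_x] := code_gt x s.
  rewrite ifN ?lt0n_neq0 //; last exact: leq_trans lt_x.
  apply: find_iota => //.
    by apply/hasP; exists (code s); rewrite ?mem_iota.
  move=> y /hasP[m _ /eqP E]; rewrite -(decodeK m) in E.
  by have [] := code_inj (x1 := y :: decode m) (x2 := x :: s) E.
apply: (cpt_app1 (h := h)) HL; apply: cpt_if; solve_cpt.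
apply: (@cpt_find _ (fun p a x =>
  has (fun m => 2 ^ x * m.*2.+1 == nth 0 a 0) (iota 0 (nth 0 a 0)))); solve_cpt.
by apply: (@cpt_has _ (fun p a m => 2 ^ nth 0 a 0 * m.*2.+1 == nth 0 (behead a) 0)); solve_cpt.
Qed.

Lemma cpt_tail n (L : (nat -> nat) -> seq nat -> seq nat) :
  cpt n (fun p a => code (L p a)) -> cpt n (fun p a => code (behead (L p a))).
Proof.
pose h c :=  if c == 0 then 0 else
  find (fun m => has (fun x => 2 ^ x * m.*2.+1 == c) (iota 0 c)) (iota 0 c).
move=> HL; apply: (@cpt_ext _ (fun p a => h (code (L p a)))).
  move=> p a _; rewrite /h; case: (L p a) => [|x s] //.
  have [lt_s lt_x] := code_gt x s.
  rewrite ifN ?lt0n_neq0 //; last exact: leq_trans lt_x.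
  apply: find_iota => //.
    by apply/hasP; exists x; rewrite ?mem_iota.
  move=> m /hasP[y _ /eqP E]; rewrite -(decodeK m) in E *.
  by have [_ ->] := code_inj (x1 := y :: decode m) (x2 := x :: s) E.
apply: (cpt_app1 (h := h)) HL; apply: cpt_if; solve_cpt.
apply: (@cpt_find _ (fun p a m =>
  has (fun x => 2 ^ x * m.*2.+1 == nth 0 a 0) (iota 0 (nth 0 a 0)))); solve_cpt.
by apply: (@cpt_has _ (fun p a x => 2 ^ x * (nth 0 a 0).*2.+1 == nth 0 (behead a) 0)); solve_cpt.
Qed.

Lemma cpt_drop n N (L : (nat -> nat) -> seq nat -> seq nat) :
  cpt n N -> cpt n (fun p a => code (L p a)) ->
  cpt n (fun p a => code (drop (N p a) (L p a))).
Proof.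
move=> HN HL; pose h m c := code (drop m (decode c)).
apply: (@cpt_ext _ (fun p a => h (N p a) (code (L p a)))).
  by move=> p a _; rewrite /h codeK.
apply: (cpt_app2 (h := h)) HN HL; rewrite /h.
apply: (@cpt_ext _ (fun p b => prec (nth 0 b 1) (fun _ r => code (behead (decode r))) (nth 0 b 0))).
  move=> p b _; elim: (nth 0 b 0) => [|k /= ->]; first by rewrite drop0 decodeK.
  by rewrite codeK -drop1 drop_drop.
apply: (@cpt_prec _ _ (fun _ _ _ r => code (behead (decode r)))); solve_cpt.
by apply: cpt_tail; apply: (@cpt_ext _ (fun p a => nth 0 a 1)) => [p a _|]; rewrite ?decodeK //; solve_cpt.
Qed.

Lemma cpt_decode n F : cpt n F -> cpt n (fun p a => code (decode (F p a))).
Proof. by apply: cpt_ext => p a _; rewrite decodeK. Qed.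

Lemma cpt_nthl n N (L : (nat -> nat) -> seq nat -> seq nat) :
  cpt n N -> cpt n (fun p a => code (L p a)) ->
  cpt n (fun p a => nth 0 (L p a) (N p a)).
Proof.
move=> HN HL; have := cpt_head (cpt_drop HN HL).
by apply: cpt_ext => p a _; rewrite -nth0 nth_drop addn0.
Qed.

(** Found by bounded search: dropping [m] items leaves code 0 from [m = size] on, and the size never
    exceeds the code. *)
Lemma cpt_size n (L : (nat -> nat) -> seq nat -> seq nat) :
  cpt n (fun p a => code (L p a)) -> cpt n (fun p a => size (L p a)).
Proof.
move=> HL; pose h c := find (fun m => code (drop m (decode c)) == 0) (iota 0 c.+1).
apply: (@cpt_ext _ (fun p a => h (code (L p a)))).
  move=> p a _; rewrite /h codeK; set s := L p a.
  have le_s : size s <= code s.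
    by elim: s => //= x s IH; have [+ _] := code_gt x s; apply: leq_trans.
  have E0 m : (code (drop m s) == 0) = (size s <= m).
    by rewrite -subn_eq0 -size_drop; case: drop => //= *; rewrite muln_eq0 expn_eq0.
  have hP : has (fun m => code (drop m s) == 0) (iota 0 (code s).+1).
    by apply/hasP; exists (size s); rewrite ?mem_iota // E0.
  apply/eqP; rewrite eqn_leq; apply/andP; split.
    rewrite leqNgt; apply/negP => /(before_find 0).
    by rewrite nth_iota ?ltnS // add0n E0 leqnn.
  have := nth_find 0 hP; rewrite nth_iota ?E0 ?add0n //.
  by rewrite -[X in _ < X](size_iota 0) -has_find.
apply: (cpt_app1 (h := h)) HL.
apply: (@cpt_find _ (fun p a m => code (drop m (decode (nth 0 a 0))) == 0)); solve_cpt.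
by apply: cpt_drop; solve_cpt; apply: cpt_decode; solve_cpt.
Qed.

Lemma cpt_mkseq n F N :
  cpt n.+1 (fun p a => F p (behead a) (nth 0 a 0)) -> cpt n N ->
  cpt n (fun p a => code (mkseq (F p a) (N p a))).
Proof.
(* Codes grow at the front of the list, so the entries are added starting from the last one. *)
move=> HF HN; apply: (@cpt_ext _ (fun p a =>
   prec (code nil) (fun i r => code (F p a (N p a - i.+1) :: decode r)) (N p a))).
  move=> p a _.
  suff H j : j <= N p a ->
     prec (code nil) (fun i r => code (F p a (N p a - i.+1) :: decode r)) j =
     code [seq F p a i | i <- iota (N p a - j) j].
    by rewrite (H _ (leqnn _)) subnn.
  elim: j => // j IH lt_j; rewrite [LHS]/= IH ?(ltnW lt_j) // codeK.
  by rewrite /= -(subSn lt_j) subSS.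
apply: (@cpt_prec _ _ (fun p a i r => code (F p a (N p a - i.+1) :: decode r))); solve_cpt.
apply: cpt_cons; last by apply: cpt_decode; solve_cpt.
set G := (fun p a => F p (behead (behead a)) _).
have [e He] := HF.
pose Gs : seq ((nat -> nat) -> seq nat -> nat) :=
  (fun p a => N p (behead (behead a)) - (nth 0 a 0).+1) ::
  [seq (fun _ a => nth 0 a i.+2) | i <- iota 0 n].
have HGs : List.Forall (cpt n.+2) Gs.
  constructor; last by apply: Forall_map => i; exact: cpt_nth.
  by solve_cpt; apply: cpt_behead2.
have := cpt_comp HF _ HGs; rewrite /= size_map size_iota => /(_ erefl).
apply: cpt_ext => p [|x [|y a]] //= [sa]; rewrite /G /=.
by rewrite -map_comp /comp /= -sa -/(mkseq _ _) mkseq_nth.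
Qed.

(** Access to the components of a search witness, which is a single number coding a list. *)
Definition cnth (z : nat) := nth 0 (decode z).

Lemma cpt_filter n (P : nat -> bool) (L : (nat -> nat) -> seq nat -> seq nat) :
  cpt 1 (fun _ b => P (nth 0 b 0)) -> cpt n (fun p a => code (L p a)) ->
  cpt n (fun p a => code [seq c <- L p a | P c]).
Proof.
move=> HP HL; pose h x := code [seq c <- decode x | P c].
apply: (@cpt_ext _ (fun p a => h (code (L p a)))).
  by move=> p a _; rewrite /h codeK.
apply: (cpt_app1 (h := h)) HL; rewrite /h.
pose el (a : seq nat) i := nth 0 (decode (nth 0 a 0)) (size (decode (nth 0 a 0)) - i.+1).
apply: (@cpt_ext _ (fun p a => prec (code nil)
  (fun i r => if P (el a i) then code (el a i :: decode r) else r)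
  (size (decode (nth 0 a 0))))).
  rewrite /el => p a _; set s := decode _.
  have H j : j <= size s -> prec (code nil)
    (fun i r => if P (nth 0 s (size s - i.+1)) then
        code (nth 0 s (size s - i.+1) :: decode r) else r) j =
    code [seq c <- drop (size s - j) s | P c].
    elim: j => [|j IH] lt_j; first by rewrite subn0 drop_size.
    rewrite [LHS]/= IH ?(ltnW lt_j) // codeK.
    have lt_s : size s - j.+1 < size s by rewrite ltn_subrL /= (leq_trans _ lt_j).
    by rewrite (drop_nth 0 lt_s) subnSK //=; case: ifP.
  by rewrite (H _ (leqnn _)) subnn drop0.
have Hd k i T : shift T -> cpt k (fun _ a => code (decode (nth 0 (T a) i))).
  by move=> HT; apply: cpt_decode; apply: cpt_var.
have S0 := shift_id; have S2 := shift_behead (shift_behead S0).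
apply: (@cpt_prec _ _ (fun _ a i r => if P (el a i) then code (el a i :: decode r) else r)).
- by solve_cpt.
- have Hel : cpt 3 (fun (_ : nat -> nat) a => el (behead (behead a)) (nth 0 a 0)).
    apply: cpt_nthl; last exact: Hd.
    by solve_cpt; apply: cpt_size; exact: Hd.
  solve_cpt; first exact: (cpt_app1 (h := P)).
  by apply: cpt_cons => //; exact: Hd.
- by apply: cpt_size; exact: Hd.
Qed.

Lemma cpt_cnth n F i : cpt n F -> cpt n (fun p a => cnth (F p a) i).
Proof. by move=> HF; apply: cpt_nthl; solve_cpt; exact: cpt_decode. Qed.

Lemma cpt_sizedec n F : cpt n F -> cpt n (fun p a => size (decode (F p a))).
Proof. by move=> HF; apply: cpt_size; exact: cpt_decode. Qed.

Ltac cpt_codes := lazymatch goal with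
  | |- cpt _ (fun p a => cnth (@?F p a) ?i) => apply: cpt_cnth
  | |- cpt _ (fun p a => size (decode (@?F p a))) => apply: cpt_sizedec
  | |- cpt _ (fun p a => head _ (decode (@?F p a))) => apply: cpt_head; apply: cpt_decode
  end.
Ltac cpt_more ::= first [cpt_codes | cpt_arith].

(** * Running a fixed machine on a coded prefix is computable *)

Definition oscode (o : option (seq nat)) := if o is Some vs then (code vs).+1 else 0.

Lemma cpt_oseq n (os : seq ((nat -> nat) -> seq nat -> option nat)) :
  List.Forall (fun o => cpt n (fun p a => osucc (o p a))) os ->
  cpt n (fun p a => oscode (oseq [seq o p a | o <- os])).
Proof.
elim=> [|o os' HO _ IH]; first exact: cpt_const.
apply: (@cpt_ext _ (fun p a =>
   let x := osucc (o p a) in let y := oscode (oseq [seq o p a | o <- os']) in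
   if (x == 0) || (y == 0) then 0 else (code (x.-1 :: decode y.-1)).+1)).
  by move=> p a _ /=; case: (o p a) => //= v; case: oseq => //= vs; rewrite codeK.
by cbv zeta; solve_cpt; apply: cpt_cons; solve_cpt; apply: cpt_decode; solve_cpt.
Qed.

(** The loop state is 0 while searching, 1 after a diverging trial and [v.+2] once [v] is found. The
    final predecessor merges the two failures into 0. *)
Lemma mu_opt_prec (F : nat -> option nat) N : osucc (mu_opt F 0 N) =
  (prec 0 (fun i st => if st == 0 then if osucc (F i) == 0 then 1
    else if osucc (F i) == 1 then i.+2 else 0 else st) N).-1.
Proof.
set s := (fun i st => _).
suff H j : j <= N -> mu_opt F 0 N =
  match prec 0 s j with 0 => mu_opt F j (N - j) | 1 => None | v.+2 => Some v end.
  by rewrite (H N (leqnn _)) subnn; case: (prec 0 s N) => [|[|v]].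
elim: j => [|j IH] lt_j; first by rewrite subn0.
rewrite IH ?(ltnW lt_j) // [prec _ _ j.+1]/=; case: (prec 0 s j) => [|[|v]] //.
rewrite -(subnSK lt_j) /= /s /=.
by case: (F j) => [[|w]|].
Qed.

Lemma cpt_ev n e (S A : (nat -> nat) -> seq nat -> seq nat) :
  cpt n (fun p a => code (S p a)) -> cpt n (fun p a => code (A p a)) ->
  cpt n (fun p a => osucc (ev (S p a) e (A p a))).
Proof.
elim/prf_nested_ind: e n S A => [||i||f gs IHf IHgs|f g IHf IHg|f IHf] n S A HS HA.
- exact: cpt_const.
- by rewrite /=; solve_cpt; apply: cpt_head.
- by rewrite /=; solve_cpt; apply: cpt_nthl; solve_cpt.
- apply: (@cpt_ext _ (fun p a => if head 0 (A p a) < size (S p a) then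
     (nth 0 (S p a) (head 0 (A p a))).+1 else 0)).
    by move=> p a _ /=; case: ifP.
  solve_cpt; [exact: cpt_head|exact: cpt_size|].
  by apply: cpt_nthl => //; exact: cpt_head.
- pose os := [seq (fun p a => ev (S p a) g (A p a)) | g <- gs].
  apply: (@cpt_ext _ (fun p a => let y := oscode (oseq [seq o p a | o <- os]) in
    if y == 0 then 0 else osucc (ev (S p a) f (decode y.-1)))).
    move=> p a _ /=; rewrite /os -map_comp /comp; case: oseq => //= vs.
    by rewrite codeK.
  have H : cpt n (fun p a => oscode (oseq [seq o p a | o <- os])).
    apply: cpt_oseq; rewrite /os; elim: IHgs => [|h gs' Hh _ IH] /=.
      exact: List.Forall_nil.
    by apply: List.Forall_cons => //; exact: Hh.
  by cbv zeta; solve_cpt; apply: IHf => //; apply: cpt_decode; solve_cpt.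
- pose h s c := osucc (ev (decode s) (PRec f g) (decode c)).
  apply: (@cpt_ext _ (fun p a => h (code (S p a)) (code (A p a)))).
    by move=> p a _; rewrite /h !codeK.
  apply: (cpt_app2 (h := h)) HS HA; rewrite /h.
  pose D i (a : seq nat) := decode (nth 0 a i).
  apply: (@cpt_ext _ (fun p a => prec (osucc (ev (D 0 a) f (behead (D 1 a))))
    (fun i r => if r == 0 then 0 else
      osucc (ev (D 0 a) g (i :: r.-1 :: behead (D 1 a)))) (head 0 (D 1 a)))).
    rewrite /D => p a _ /=; elim: (head 0 _) => //= x ->.
    by case: rec_opt.
  have HD k i T : shift T -> cpt k (fun p a => code (D i (T a))).
    by move=> HT; apply: cpt_decode; apply: cpt_var.
  have H0 := shift_id.
  apply: (@cpt_prec _ _ (fun p a i r => if r == 0 then 0 else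
      osucc (ev (D 0 a) g (i :: r.-1 :: behead (D 1 a))))).
  + by apply: IHf; [exact: HD|apply: cpt_tail; exact: HD].
  + have H2 := shift_behead (shift_behead H0).
    solve_cpt; apply: IHg; first exact: HD.
    apply: cpt_cons; first by solve_cpt.
    by apply: cpt_cons; solve_cpt; apply: cpt_tail; exact: HD.
  + by apply: cpt_head; exact: HD.
- pose h s c := osucc (ev (decode s) (PMu f) (decode c)).
  apply: (@cpt_ext _ (fun p a => h (code (S p a)) (code (A p a)))).
    by move=> p a _; rewrite /h !codeK.
  apply: (cpt_app2 (h := h)) HS HA; rewrite /h.
  pose D i (a : seq nat) := decode (nth 0 a i).
  have HD k i T : shift T -> cpt k (fun p a => code (D i (T a))).
    by move=> HT; apply: cpt_decode; apply: cpt_var.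
  have H0 := shift_id; have H2 := shift_behead (shift_behead H0).
  pose st := fun (a : seq nat) i r => if r == 0 then
    if osucc (ev (D 0 a) f (i :: D 1 a)) == 0 then 1
    else if osucc (ev (D 0 a) f (i :: D 1 a)) == 1 then i.+2 else 0 else r.
  apply: (@cpt_ext _ (fun p a => (prec 0 (st a) (size (D 0 a))).-1)).
    by move=> p a _; rewrite -mu_opt_prec.
  apply: cpt_pred; apply: (@cpt_prec _ _ (fun p a => st a)); solve_cpt.
    have H : cpt 4 (fun (_ : nat -> nat) a => osucc (ev (D 0 (behead (behead a))) f
        (nth 0 a 0 :: D 1 (behead (behead a))))).
      by apply: IHf; [exact: HD|apply: cpt_cons; solve_cpt; exact: HD].
    by rewrite /st; solve_cpt.
  by apply: cpt_size; exact: HD.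
Qed.

(** The conclusion promises only some passing witness for each entry. This is all that a
    multi-valued output requires, and a single-valued one follows if every passing witness gives a
    correct entry. *)
Lemma realizes_search (Chk : (nat -> nat) -> nat -> nat -> bool)
    (Out : (nat -> nat) -> nat -> nat -> nat) :
  cpt 2 (fun p a => Chk p (nth 0 a 0) (nth 0 a 1)) ->
  cpt 2 (fun p a => Out p (nth 0 a 0) (nth 0 a 1)) ->
  exists e, forall p, (forall k, exists w, Chk p w k) ->
  exists q, realizes e p q /\ forall k, exists2 w, Chk p w k & q k = Out p w k.
Proof.
move=> /cpt_neg[c Hc] [o Ho].
exists (PComp o [:: PMu c; PProj 0]) => p Hw.
exists (fun k => Out p (ex_minn (Hw k)) k); split=> k; last first.
  by exists (ex_minn (Hw k)) => //; case: ex_minnP.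
case: ex_minnP => w Hwk Hmin.
apply: (@computes_comp _ _ _ _ [:: w; k]); last exact: (Ho p [:: w; k]).
constructor; last by constructor; [exists 1|constructor].
apply: (computes_mu (h := fun y => ~~ Chk p y k)) => [y _||y lt_y].
- exact: (Hc p [:: y; k]).
- by rewrite Hwk.
- by rewrite eqb0 negbK; apply: contraL lt_y => /Hmin; rewrite -leqNgt.
Qed.

Lemma realizes_total (F : (nat -> nat) -> nat -> nat) :
  cpt 1 (fun p a => F p (nth 0 a 0)) -> exists e, forall p, realizes e p (F p).
Proof. by move=> [e He]; exists e => p k; exact: (He p [:: k]). Qed.

Local Open Scope ring_scope.

(** * Decoding the codes of rationals, vectors and balls *)

(* [unpickle] on [int] goes through [nat + nat], coded as a pair of options,
   that is of sequences of length at most one: the first one holds a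
   nonnegative integer, the second one a negative integer, and the second one
   wins when both are nonempty. *)
Definition valid_int (z : nat) : bool :=
  (size (decode z) == 2) && ((cnth z 1 != 0) || (cnth z 0 != 0))%N.
Definition zpos (z : nat) : nat :=
  if cnth z 1 == 0%N then head 0%N (decode (cnth z 0)) else 0%N.
Definition zneg (z : nat) : nat :=
  if cnth z 1 == 0%N then 0%N else (head 0%N (decode (cnth z 1))).+1.

Lemma decode_eq0 c : (decode c == [::]) = (c == 0%N).
Proof. by apply/eqP/eqP => [E|-> //]; rewrite -(decodeK c) E. Qed.

Lemma ohead_decode c : ohead (decode c) =
  if c == 0%N then None else Some (head 0%N (decode c)).
Proof. by rewrite -decode_eq0; case: decode. Qed.

Lemma unpickle_int z : @unpickle int z =
  if valid_int z then Some ((zpos z)%:Z - (zneg z)%:Z) else None.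
Proof.
transitivity (omap int_of_natsum (obind sum_of_opair
  (if decode z is [:: a; b] then Some (ohead (decode a), ohead (decode b)) else None))).
  transitivity (omap int_of_natsum (obind sum_of_opair (omap
   (@pair_of_tag (option nat) (option nat)) (unpickle z)))); first by [].
  rewrite /unpickle/= /unpickle_tagged /=.
  case: (decode z) => [|a [|b [|c s]]] //.
  congr (omap _ (obind _ _)).
  rewrite /= /unpickle /= /unpickle_seq /pcomp /=.
  have pS (s : seq nat) : pmap Some s = s by elim: s => //= x s ->.
  by rewrite !pS.
rewrite /valid_int /zpos /zneg /cnth; case: (decode z) => [|a [|b [|c s]]] //=.
rewrite !ohead_decode; case: (b == 0%N) => /=; last first.
  by case: (a == 0%N); rewrite /= NegzE sub0r.
by case: (a == 0%N) => //=; rewrite subr0.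
Qed.

(** The invariant of the type [rat]: positive denominator, coprime to the numerator. As one of
    [zpos] and [zneg] is always 0, their sum is the absolute value. *)
Definition valid_rat (k : nat) : bool :=
  let z1 := cnth k 0 in let z2 := cnth k 1 in
  [&& size (decode k) == 2, valid_int z1, valid_int z2, zneg z2 == 0%N, 0 < zpos z2
    & coprime (zpos z1 + zneg z1) (zpos z2)]%N.

Definition ratval (k : nat) : rat :=
  if valid_rat k then ((zpos (cnth k 0))%:R - (zneg (cnth k 0))%:R) / (zpos (cnth k 1))%:R
  else 0.

Lemma unpickle_rat k : @unpickle rat k = if valid_rat k then Some (ratval k) else None.
Proof.
transitivity (obind insub
  (if decode k is [:: a; b] then obind (fun x => omap (pair x) (unpickle b : option int))
     (unpickle a : option int) else None) : option rat).
  transitivity (obind insub (omap (@pair_of_tag int int) (unpickle k)) : option rat).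
    by [].
  rewrite {1}/unpickle/= /unpickle_tagged /=.
  case: (decode k) => [|a [|b [|c s]]] //.
  by case: (unpickle a) => //= x; case: (unpickle b).
rewrite /ratval /valid_rat /cnth; case: (decode k) => [|a [|b [|c s]]] //=.
rewrite !unpickle_int; case: (valid_int a) => //=; case: (valid_int b) => //=.
set x := zpos a; set y := zneg a.
have xy : (x == 0%N) || (y == 0%N).
  by rewrite /x /y /zpos /zneg; case: (cnth a 1 == 0%N); rewrite ?eqxx ?orbT.
have zw : (zpos b == 0%N) || (zneg b == 0%N).
  by rewrite /zpos /zneg; case: (cnth b 1 == 0%N); rewrite ?eqxx ?orbT.
move: zw; case: (eqVneq (zneg b) 0%N) => [-> _|nz] /=; last first.
  rewrite orbF => /eqP ->; rewrite insubF //=.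
  by rewrite sub0r oppr_gt0 ltz_nat.
rewrite subr0 /=; set z := zpos b.
have -> : coprime (x + y)%N z = coprime `|x%:Z - y%:Z|%N `|z%:Z|%N.
  congr coprime; case/orP: xy => /eqP->; rewrite ?add0n ?sub0r ?abszN ?absz_nat ?addn0 ?subr0 //.

rewrite -ltz_nat; case: insubP => [u /= -> uE|/negbTE /= -> //].
congr Some; apply: val_inj; transitivity (x%:Z - y%:Z, z%:Z); first exact: uE.
have : (0 < (valq u).2) && coprime `|(valq u).1| `|(valq u).2| by exact: valP u.
rewrite uE /= => /andP[z0 cop].
have -> : (x%:R - y%:R : rat) / z%:R = (x%:Z - y%:Z)%:~R / z%:Z%:~R.
  by rewrite rmorphB.
have -> : val ((x%:Z - y%:Z)%:~R / z%:Z%:~R : rat) =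
  (numq ((x%:Z - y%:Z)%:~R / z%:Z%:~R : rat), denq ((x%:Z - y%:Z)%:~R / z%:Z%:~R)).
  by rewrite /numq /denq -surjective_pairing.
rewrite coprimeq_num // coprimeq_den //.
by rewrite gtr0_sg // mul1r gt_eqF // gtr0_norm.
Qed.

Lemma decQE k : decQ k = ratval k.
Proof.
have -> : decQ k = odflt 0 (@unpickle rat k) by [].
by rewrite unpickle_rat /ratval; case: (valid_rat k).
Qed.

Section Vec.
Variable d : nat.
Local Notation I := ('I_1 * 'I_d)%type.
Local Notation T := {x : I & rat}.

Definition valid_idx (c : nat) : bool :=
  (size (decode c) == 2) && (cnth c 0 < 1)%N && (cnth c 1 < d)%N.

Lemma unpickle_idx c : if @unpickle I c is Some x
  then valid_idx c /\ val x.2 = cnth c 1 else ~~ valid_idx c.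
Proof.
have -> : @unpickle I c = (if decode c is [:: a; b] then
    obind (fun x => omap (pair x) (insub b : option 'I_d)) (insub a : option 'I_1) else None).
  transitivity (omap (@pair_of_tag 'I_1 'I_d) (unpickle c)); first by [].
  rewrite {1}/unpickle/= /unpickle_tagged /=.
  case: (decode c) => [|a [|b [|e s]]] //.
  rewrite /unpickle /= /pcomp /=.
  by case: (insub a) => //= x; case: (insub b).
rewrite /valid_idx /cnth; case: (decode c) => [|a [|b [|e s]]] //=.
case: insubP => [y yb E|/negbTE /= nb]; case: insubP => [x xa _|/negbTE /= na] /=.
- by rewrite xa yb.
- by rewrite na.
- by rewrite nb andbF.
- by rewrite na.
Qed.

Definition valid_tag (c : nat) : bool :=
  [&& size (decode c) == 2, valid_idx (cnth c 0) & valid_rat (cnth c 1)].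

Lemma unpickle_tag c : if @unpickle T c is Some u
  then [/\ valid_tag c, val (tag u).2 = cnth (cnth c 0) 1 & tagged u = ratval (cnth c 1)]
  else ~~ valid_tag c.
Proof.
have -> : @unpickle T c = if decode c is [:: a; b] then
    obind (fun i => omap (@Tagged I i (fun _ => rat)) (unpickle b)) (unpickle a) else None by [].
rewrite /valid_tag /cnth; case: (decode c) => [|a [|b [|e s]]] //=.
have := unpickle_idx a; rewrite /cnth; case: (unpickle a) => [x [-> xE]|/negbTE ->] //=.
by rewrite unpickle_rat; case: (valid_rat b).
Qed.

(* A vector is coded by the list of its (index, entry) pairs.  [unpickle] on
   sequences silently drops the items that do not decode, so the size test and
   the positions refer to the filtered list. *)
Definition tagcodes (k : nat) : seq nat := [seq c <- decode k | valid_tag c].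

Lemma size_pmap_tag k : size (pmap (@unpickle T) (decode k)) = size (tagcodes k).
Proof.
rewrite /tagcodes; elim: (decode k) => [|c s IH] //=.
have := unpickle_tag c; case: (unpickle c) => [u [-> _ _]|/negbTE -> //] /=.
by rewrite IH.
Qed.

Lemma nth_pmap_tag (def : T) k j : (j < size (tagcodes k))%N ->
  let u := nth def (pmap (@unpickle T) (decode k)) j in
  let c := nth 0%N (tagcodes k) j in
  val (tag u).2 = cnth (cnth c 0) 1 /\ tagged u = ratval (cnth c 1).
Proof.
rewrite /tagcodes; elim: (decode k) j => [|c s IH] j //=.
have := unpickle_tag c; case: (unpickle c) => [u [-> uE rE]|/negbTE ->] /=.
  by case: j => [|j] // /IH.
exact: IH.
Qed.

Definition valid_vec (k : nat) : bool := (size (tagcodes k) == #|{: I}|) &&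
  all (fun j : 'I_d => cnth (cnth (nth 0%N (tagcodes k) (enum_rank (ord0 : 'I_1, j))) 0) 1 == j)
      (enum 'I_d).

Definition coordcode (i : 'I_d) (k : nat) : nat :=
  if valid_vec k then cnth (nth 0%N (tagcodes k) (enum_rank (ord0 : 'I_1, i))) 1 else 0%N.

Lemma unpickle_vec k : if @unpickle 'rV[rat]_d k is Some v then
  valid_vec k /\ forall i, v 0 i = ratval (coordcode i k) else ~~ valid_vec k.
Proof.
have -> : @unpickle 'rV[rat]_d k = obind (fun f => insub f : option 'rV[rat]_d)
   (obind (@finfun.tfgraph_inv I (fun _ => rat))
     (insub (pmap (@unpickle T) (decode k)) : option (#|{: I}|.-tuple T))).
  reflexivity.
have E (o : option {ffun I -> rat}) :
    obind (fun f => insub f : option 'rV[rat]_d) o = omap (@Matrix rat 1 d) o.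
  case: o => [f|] //=; case: insubP => [u _ <-|//]; by case: u.
rewrite E {E}.
have szE := size_pmap_tag k.
case: (insubP (#|{: I}|.-tuple T) (pmap (@unpickle T) (decode k)))
  => [G /eqP sG GE|/= nsG] /=; last by rewrite /valid_vec -szE negb_and nsG.
have GE' : tval G = pmap (@unpickle T) (decode k) := GE.
have tG (j : 'I_d) : let u := tnth G (enum_rank (ord0 : 'I_1, j)) in
    let c := nth 0%N (tagcodes k) (enum_rank (ord0 : 'I_1, j)) in
    val (tag u).2 = cnth (cnth c 0) 1 /\ tagged u = ratval (cnth c 1).
  pose def : T := @Tagged I (ord0, j) (fun _ => rat) 0.
  rewrite (tnth_nth def) GE'; apply: nth_pmap_tag.
  by rewrite -szE sG.
rewrite /finfun.tfgraph_inv; case: eqfunP => [Dtg|nD] /=.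
  have vk : valid_vec k.
    rewrite /valid_vec -szE sG eqxx; apply/allP => j _.
    by have [<- _] := tG j; rewrite Dtg.
  split=> // i; rewrite /coordcode vk -(proj2 (tG i)) /fun_of_matrix /= ffunE.
  have ecastK (A B : Type) (x y : A) (e : x = y) (v : B) : ecast z B e v = v by case: y / e.
  exact: ecastK.
apply/negP => /andP[_ /allP H]; apply: nD => -[i j].
have /H/eqP : j \in enum 'I_d by rewrite mem_enum.
rewrite (ord1 i) -(proj1 (tG j)); case: (tag _) => [i' j'] /= /val_inj ->.
by rewrite (ord1 i').
Qed.
End Vec.

Lemma ratval0 : ratval 0 = 0. Proof. by []. Qed.

Lemma decVE d k i : decV d k 0 i = ratval (coordcode i k).
Proof.
have -> : decV d k = odflt 0 (@unpickle 'rV[rat]_d k) by [].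
have := unpickle_vec d k; case: (unpickle k) => [v [_ ->] //|/negbTE nv] /=.
by rewrite mxE /coordcode nv ratval0.
Qed.

(** Code 0 decodes to the zero vector and to the zero rational, the defaults of [decB], so invalid
    codes fit the same formula. *)
Definition ballcode (d k : nat) : nat * nat :=
  if [&& size (decode k) == 2, valid_vec d (cnth k 0) & valid_rat (cnth k 1)]
  then (cnth k 0, cnth k 1) else (0, 0)%N.

Lemma decBE d k : decB d k = (decV d (ballcode d k).1, decQ (ballcode d k).2).
Proof.
have -> : decB d k = odflt (0, 0) (if decode k is [:: a; b] then
   obind (fun x => omap (pair x) (@unpickle rat b)) (@unpickle 'rV[rat]_d a) else None).
  transitivity (odflt (0, 0) (omap (@pair_of_tag 'rV[rat]_d rat) (unpickle k))); first by [].
  rewrite {1}/unpickle/= /unpickle_tagged /=.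
  case: (decode k) => [|a [|b [|c s]]] //.
  by case: (@unpickle 'rV[rat]_d a) => //= x; case: (unpickle b).
have D0 : (decV d 0, decQ 0) = (0, 0) :> 'rV[rat]_d * rat.
  congr pair; apply/rowP => i; rewrite decVE mxE.
  by rewrite /coordcode /tagcodes /= nth_nil; case: (valid_vec d 0).
rewrite /ballcode /cnth; case: (decode k) => [|a [|b [|c s]]] //.
rewrite [size _ == 2]/= [nth _ _ 0]/= [nth _ _ 1]/= andTb.
have : decV d a = odflt 0 (@unpickle 'rV[rat]_d a) by [].
have := unpickle_vec d a.
case: (@unpickle 'rV[rat]_d a) => [v [-> _]|/negbTE -> //] /= Ea.
by rewrite unpickle_rat; case: ifP => //= vb; rewrite Ea decQE.
Qed.

(** * Computable rational functionals *)

(** No reduced form is asked for: sums and products are then polynomial in the three naturals, and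
    comparisons reduce to comparisons of naturals. *)
Definition crat n (Q : (nat -> nat) -> seq nat -> rat) := exists A B D,
  [/\ cpt n A, cpt n B, cpt n D & forall p a, size a = n ->
    Q p a = ((A p a)%:R - (B p a)%:R) / (D p a).+1%:R].

Lemma crat_ext n Q Q' : (forall p a, size a = n -> Q p a = Q' p a) -> crat n Q -> crat n Q'.
Proof.
move=> E [A [B [D [HA HB HD H]]]]; exists A, B, D; split=> // p a sa.
by rewrite -E // H.
Qed.

Lemma crat_nat n F : cpt n F -> crat n (fun p a => (F p a)%:R).
Proof.
move=> HF; exists F, (fun _ _ => 0)%N, (fun _ _ => 0)%N; split=> //; solve_cpt.
by move=> p a _; rewrite subr0 divr1.
Qed.

Lemma crat_add n Q Q' : crat n Q -> crat n Q' -> crat n (fun p a => Q p a + Q' p a).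
Proof.
move=> [A [B [D [HA HB HD H]]]] [A' [B' [D' [HA' HB' HD' H']]]].
exists (fun p a => A p a * (D' p a).+1 + A' p a * (D p a).+1)%N,
  (fun p a => B p a * (D' p a).+1 + B' p a * (D p a).+1)%N,
  (fun p a => ((D p a).+1 * (D' p a).+1).-1); split; solve_cpt.
move=> p a sa; rewrite H // H' // prednK // !natrD !natrM addf_div ?pnatr_eq0 //.
by congr (_ / _); rewrite opprD mulrBl mulrBl addrACA.
Qed.

Lemma crat_opp n Q : crat n Q -> crat n (fun p a => - Q p a).
Proof.
move=> [A [B [D [HA HB HD H]]]]; exists B, A, D; split=> // p a sa.
by rewrite H // -mulNr opprB.
Qed.

Lemma crat_mul n Q Q' : crat n Q -> crat n Q' -> crat n (fun p a => Q p a * Q' p a).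
Proof.
move=> [A [B [D [HA HB HD H]]]] [A' [B' [D' [HA' HB' HD' H']]]].
exists (fun p a => A p a * A' p a + B p a * B' p a)%N,
  (fun p a => A p a * B' p a + B p a * A' p a)%N,
  (fun p a => ((D p a).+1 * (D' p a).+1).-1); split; solve_cpt.
move=> p a sa; rewrite H // H' // prednK // !natrD !natrM mulf_div.
by congr (_ / _); ring.
Qed.

Lemma crat_inv n F : cpt n F -> crat n (fun p a => ((F p a)%:R)^-1).
Proof.
move=> HF; exists (fun p a => F p a != 0 : nat)%N, (fun _ _ => 0)%N, (fun p a => (F p a).-1).
split; solve_cpt; move=> p a _; rewrite subr0; case: (F p a) => [|k] /=; last by rewrite div1r.
by rewrite invr0 mul0r.
Qed.

Lemma crat_if n (b : (nat -> nat) -> seq nat -> bool) Q Q' : cpt n b ->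
  crat n Q -> crat n Q' -> crat n (fun p a => if b p a then Q p a else Q' p a).
Proof.
move=> Hb [A [B [D [HA HB HD H]]]] [A' [B' [D' [HA' HB' HD' H']]]].
exists (fun p a => if b p a then A p a else A' p a),
  (fun p a => if b p a then B p a else B' p a),
  (fun p a => if b p a then D p a else D' p a); split; solve_cpt.
by move=> p a sa; case: (b p a); [apply: H|apply: H'].
Qed.

Lemma crat_le n Q Q' : crat n Q -> crat n Q' -> cpt n (fun p a => Q p a <= Q' p a).
Proof.
move=> [A [B [D [HA HB HD H]]]] [A' [B' [D' [HA' HB' HD' H']]]].
apply: (@cpt_ext _ (fun p a => A p a * (D' p a).+1 + B' p a * (D p a).+1
   <= A' p a * (D p a).+1 + B p a * (D' p a).+1)%N); last by solve_cpt.
move=> p a sa; rewrite H // H' // ler_pdivrMr ?ltr0n // mulrAC ler_pdivlMr ?ltr0n //.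
by rewrite !mulrBl lerBlDr addrAC lerBrDr -!natrM -!natrD ler_nat.
Qed.

Lemma crat_lt n Q Q' : crat n Q -> crat n Q' -> cpt n (fun p a => Q p a < Q' p a).
Proof.
move=> HQ HQ'; apply: (@cpt_ext _ (fun p a => ~~ (Q' p a <= Q p a))).
  by move=> p a _; rewrite -ltNge.
by apply: cpt_neg; apply: crat_le.
Qed.

Lemma crat_eq n Q Q' : crat n Q -> crat n Q' -> cpt n (fun p a => Q p a == Q' p a).
Proof.
move=> HQ HQ'; apply: (@cpt_ext _ (fun p a => (Q p a <= Q' p a) && (Q' p a <= Q p a))).
  by move=> p a _; rewrite -eq_le.
by apply: cpt_and; apply: crat_le.
Qed.

Lemma crat_const n q : crat n (fun _ _ => q).
Proof.
rewrite -(divq_num_den q); apply: crat_mul.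
  case: (numq q) => k; first by apply: crat_nat; solve_cpt.
  rewrite NegzE; apply: (@crat_ext _ (fun _ _ => - (k.+1)%:R)) => [p a _|].
    by rewrite rmorphN.
  by apply: crat_opp; apply: crat_nat; solve_cpt.
case: (denq q) (denq_gt0 q) => // k _.
by apply: (@crat_inv _ (fun _ _ => k)); solve_cpt.
Qed.

Lemma crat_sum n (I : finType) (Q : I -> (nat -> nat) -> seq nat -> rat) :
  (forall i, crat n (Q i)) -> crat n (fun p a => \sum_i Q i p a).
Proof.
move=> HQ; elim: (index_enum I) => [|i s IH].
  by apply: (@crat_ext _ (fun _ _ => 0)) => [p a _|]; [rewrite big_nil|exact: crat_const].
apply: (@crat_ext _ (fun p a => Q i p a + \sum_(j <- s) Q j p a)) => [p a _|].
  by rewrite big_cons.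
exact: crat_add.
Qed.

Lemma cpt_forall n (I : finType) (P : I -> (nat -> nat) -> seq nat -> bool) :
  (forall i, cpt n (P i)) -> cpt n (fun p a => [forall i, P i p a]).
Proof.
move=> HP; apply: (@cpt_ext _ (fun p a => all (fun i => P i p a) (enum I))).
  move=> p a _; congr nat_of_bool; apply/allP/forallP => H i; last by move=> _; apply: H.
  by apply: H; rewrite mem_enum.
elim: (enum I) => [|i s IH] /=; first exact: cpt_const.
exact: cpt_and.
Qed.

Lemma cpt_dvdn n F G : cpt n F -> cpt n G -> cpt n (fun p a => F p a %| G p a)%N.
Proof.
apply: (cpt_app2 (h := fun x y => (x %| y)%N)).
apply: (@cpt_ext _ (fun p a => has (fun q => q * nth 0 a 0 == nth 0 a 1)
   (iota 0 (nth 0 a 1).+1))%N).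
  move=> p a _; congr nat_of_bool; apply/hasP/dvdnP => [[q _ /eqP <-]|[q E]]; first by exists q.
  set x := nth 0%N a 0 in E *; set y := nth 0%N a 1 in E *.
  have [x0|x0] := posnP x; first by exists 0%N; rewrite ?mem_iota // E x0 !muln0.
  by exists q; rewrite ?E // mem_iota /= add0n ltnS leq_pmulr.
by apply: (@cpt_has _ (fun p a q => q * nth 0 a 0 == nth 0 a 1)%N); solve_cpt.
Qed.

Lemma cpt_coprime n F G : cpt n F -> cpt n G -> cpt n (fun p a => coprime (F p a) (G p a)).
Proof.
apply: (cpt_app2 (h := coprime)).
apply: (@cpt_ext _ (fun p a =>
   all (fun d => ~~ ((d %| nth 0 a 0) && (d %| nth 0 a 1)) || (d == 1))
   (iota 0 ((nth 0 a 0 + nth 0 a 1).+2)))%N).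
  move=> p a _; set x := nth 0%N a 0; set y := nth 0%N a 1; congr nat_of_bool.
  apply/allP/idP => [H|cop d _].
    have := H (gcdn x y); rewrite dvdn_gcdl dvdn_gcdr /coprime orFb; apply.
    rewrite mem_iota /= add0n !ltnS; have [x0|x0] := posnP x.
      by rewrite x0 gcd0n add0n.
    by apply: leqW; apply: leq_trans (leq_addr _ _); apply: dvdn_leq => //; exact: dvdn_gcdl.
  rewrite -implybE -dvdn_gcd; apply/implyP; move: cop => /eqP ->.
  by rewrite dvdn1.
apply: (@cpt_all _ (fun p a d => ~~ ((d %| nth 0 a 0) && (d %| nth 0 a 1)) || (d == 1))%N); solve_cpt.
  by apply: cpt_dvdn; solve_cpt.
by apply: cpt_dvdn; solve_cpt.
Qed.

Section Decoders.
Local Open Scope nat_scope.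

Lemma cpt_valid_int n F : cpt n F -> cpt n (fun p a => valid_int (F p a)).
Proof. by move=> HF; rewrite /valid_int; solve_cpt. Qed.

Lemma cpt_zpos n F : cpt n F -> cpt n (fun p a => zpos (F p a)).
Proof. by move=> HF; rewrite /zpos; solve_cpt. Qed.

Lemma cpt_zneg n F : cpt n F -> cpt n (fun p a => zneg (F p a)).
Proof. by move=> HF; rewrite /zneg; solve_cpt. Qed.

Lemma cpt_valid_rat n F : cpt n F -> cpt n (fun p a => valid_rat (F p a)).
Proof.
move=> HF; rewrite /valid_rat; solve_cpt;
  repeat first [apply: cpt_valid_int | apply: cpt_zneg | apply: cpt_zpos
    | apply: cpt_coprime | progress solve_cpt].
Qed.

Lemma crat_ratval n F : cpt n F -> crat n (fun p a => ratval (F p a)).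
Proof.
move=> HF; apply: crat_if; [exact: cpt_valid_rat| |exact: crat_const].
apply: crat_mul; last by apply: crat_inv; apply: cpt_zpos; solve_cpt.
apply: crat_add; first by apply: crat_nat; apply: cpt_zpos; solve_cpt.
by apply: crat_opp; apply: crat_nat; apply: cpt_zneg; solve_cpt.
Qed.

Lemma crat_decQ n F : cpt n F -> crat n (fun p a => decQ (F p a)).
Proof. by move=> /crat_ratval; apply: crat_ext => p a _; rewrite decQE. Qed.

Lemma cpt_tagcodes n d F : cpt n F -> cpt n (fun p a => code (tagcodes d (F p a))).
Proof.
move=> HF; apply: cpt_filter; last exact: cpt_decode.
by rewrite /valid_tag /valid_idx; solve_cpt; apply: cpt_valid_rat; solve_cpt.
Qed.

Lemma cpt_valid_vec n d F : cpt n F -> cpt n (fun p a => valid_vec d (F p a)).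
Proof.
move=> HF; have HT := cpt_tagcodes d HF; rewrite /valid_vec; solve_cpt; first exact: cpt_size.
elim: (enum 'I_d) => [|i s IH] /=; first exact: cpt_const.
by solve_cpt; apply: cpt_nthl; solve_cpt.
Qed.

Lemma cpt_coordcode n d (i : 'I_d) F : cpt n F -> cpt n (fun p a => coordcode i (F p a)).
Proof.
move=> HF; have HT := cpt_tagcodes d HF; rewrite /coordcode; solve_cpt; first exact: cpt_valid_vec.
by apply: cpt_nthl; solve_cpt.
Qed.

Lemma crat_decV n d (i : 'I_d) F : cpt n F -> crat n (fun p a => decV d (F p a) 0%R i).
Proof.
move=> /(cpt_coordcode i)/crat_ratval.
by apply: crat_ext => p a _; rewrite decVE.
Qed.

Lemma cpt_ballcode n d F : cpt n F ->
  cpt n (fun p a => (ballcode d (F p a)).1) /\ cpt n (fun p a => (ballcode d (F p a)).2).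
Proof.
move=> HF; pose b p a := [&& size (decode (F p a)) == 2, valid_vec d (cnth (F p a) 0)
   & valid_rat (cnth (F p a) 1)].
have Hb : cpt n b by rewrite /b; solve_cpt; [apply: cpt_valid_vec|apply: cpt_valid_rat]; solve_cpt.
split.
  apply: (@cpt_ext _ (fun p a => if b p a then cnth (F p a) 0 else 0)).
    by move=> p a _; rewrite /ballcode /b; case: ifP.
  by solve_cpt.
apply: (@cpt_ext _ (fun p a => if b p a then cnth (F p a) 1 else 0)).
  by move=> p a _; rewrite /ballcode /b; case: ifP.
by solve_cpt.
Qed.

Lemma crat_decB1 n d (i : 'I_d) F : cpt n F -> crat n (fun p a => (decB d (F p a)).1 0%R i).
Proof.
move=> /(cpt_ballcode d)[/(crat_decV i) H _].
by apply: crat_ext H => p a _; rewrite decBE.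
Qed.

Lemma crat_decB2 n d F : cpt n F -> crat n (fun p a => (decB d (F p a)).2).
Proof.
move=> /(cpt_ballcode d)[_ /crat_decQ H].
by apply: crat_ext H => p a _; rewrite decBE.
Qed.

End Decoders.

(** * Euclidean norm and names of points *)

Section Enorm.
Variable d : nat.
Implicit Types u v w x y : 'rV[R]_d.

Lemma cauchy_schwarz (a b : 'I_d -> R) :
  (\sum_i a i * b i) ^+ 2 <= (\sum_i a i ^+ 2) * (\sum_i b i ^+ 2).
Proof.
set A := \sum_i a i ^+ 2; set B := \sum_i b i ^+ 2; set C := \sum_i a i * b i.
have B0 : 0 <= B by apply: sumr_ge0 => i _; apply: sqr_ge0.
have [B0'|B_neq0] := eqVneq B 0.
  have b0 i : b i = 0.
    apply/eqP; rewrite -sqrf_eq0 eq_le sqr_ge0 andbT -B0' /B (bigD1 i) //= lerDl.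
    by apply: sumr_ge0 => j _; apply: sqr_ge0.
  by rewrite /C big1 ?expr0n /= ?B0' ?mulr0 // => i _; rewrite b0 mulr0.
have Bp : 0 < B by rewrite lt_def B_neq0.
have : 0 <= \sum_i (B * a i - C * b i) ^+ 2 by apply: sumr_ge0 => i _; apply: sqr_ge0.
have -> : \sum_i (B * a i - C * b i) ^+ 2 = B * (A * B - C ^+ 2).
  transitivity (\sum_i (B ^+ 2 * a i ^+ 2 - (B * C *+ 2) * (a i * b i) + C ^+ 2 * b i ^+ 2)).
    by apply: eq_bigr => i _; ring.
  rewrite big_split sumrB -!mulr_sumr /= -/A -/B -/C. ring.
by rewrite pmulr_rge0 // subr_ge0.
Qed.

Lemma enorm_ge0 u : 0 <= enorm u. Proof. exact: sqrtr_ge0. Qed.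

Lemma sqr_enorm u : enorm u ^+ 2 = \sum_i u 0 i ^+ 2.
Proof. by rewrite sqr_sqrtr //; apply: sumr_ge0 => i _; apply: sqr_ge0. Qed.

Lemma enormN u : enorm (- u) = enorm u.
Proof. by rewrite /enorm; congr Num.sqrt; apply: eq_bigr => i _; rewrite mxE sqrrN. Qed.

Lemma enorm_sym u v : enorm (u - v) = enorm (v - u).
Proof. by rewrite -enormN opprB. Qed.

Lemma enorm0 : enorm (0 : 'rV[R]_d) = 0.
Proof. by rewrite /enorm big1 ?sqrtr0 // => i _; rewrite mxE expr0n. Qed.

Lemma enormD u v : enorm (u + v) <= enorm u + enorm v.
Proof.
rewrite -ler_sqr ?nnegrE ?addr_ge0 ?enorm_ge0 // sqrrD !sqr_enorm.
have -> : \sum_i (u + v) 0 i ^+ 2 =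
    \sum_i u 0 i ^+ 2 + (\sum_i u 0 i * v 0 i) *+ 2 + \sum_i v 0 i ^+ 2.
  rewrite -sumrMnl -!big_split; apply: eq_bigr => i _.
  by rewrite mxE sqrrD.
rewrite lerD2r lerD2l lerMn2r /=.
apply: le_trans (ler_norm _) _.
rewrite -ler_sqr ?nnegrE ?mulr_ge0 ?enorm_ge0 ?normr_ge0 // exprMn !sqr_enorm.
by rewrite real_normK ?num_real //; apply: cauchy_schwarz.
Qed.

Lemma enorm_tri w u v : enorm (u - v) <= enorm (u - w) + enorm (w - v).
Proof. by have := enormD (u - w) (w - v); rewrite addrA subrK. Qed.

Lemma enorm_tri_lt w u v (s t : R) :
  enorm (u - w) < s -> enorm (w - v) < t -> enorm (u - v) < s + t.
Proof. by move=> h1 h2; apply: le_lt_trans (enorm_tri w u v) (ltrD h1 h2). Qed.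

Lemma coord_le_enorm u i : `|u 0 i| <= enorm u.
Proof.
rewrite -ler_sqr ?nnegrE ?enorm_ge0 ?normr_ge0 // sqr_enorm real_normK ?num_real //.
by rewrite (bigD1 i) //= lerDl; apply: sumr_ge0 => j _; apply: sqr_ge0.
Qed.

Lemma enorm_le_sum u : enorm u <= \sum_i `|u 0 i|.
Proof.
rewrite -ler_sqr ?nnegrE ?enorm_ge0 ?sumr_ge0 // sqr_enorm.
suff H (s : seq 'I_d) : \sum_(i <- s) u 0 i ^+ 2 <= (\sum_(i <- s) `|u 0 i|) ^+ 2 by exact: H.
elim: s => [|i s IH]; first by rewrite !big_nil expr0n.
rewrite !big_cons sqrrD -addrA real_normK ?num_real // lerD2l.
by apply: le_trans IH _; rewrite lerDr mulrn_wge0 // mulr_ge0 // sumr_ge0.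
Qed.

(** The crude factor [d] in place of its square root keeps the bound rational. It is the source of
    the margins [d%:R * h] in the grid test. *)
Lemma enorm_le_coord u (c : R) : (forall i, `|u 0 i| <= c) -> enorm u <= d%:R * c.
Proof.
move=> H; apply: le_trans (enorm_le_sum u) _.
by rewrite -[d in d%:R]card_ord mulr_natl -sumr_const; apply: ler_sum.
Qed.

Lemma rat_dense x (eps : R) : 0 < eps ->
  exists q : 'rV[rat]_d, enorm (vratr q - x) < eps.
Proof.
(* Dividing by [d.+1] is safe for [d = 0] and makes the final bound strict. *)
move=> e0; pose c := eps / d.+1%:R; have c0 : 0 < c by rewrite divr_gt0 ?ltr0n.
have H i : exists q : rat, x 0 i - c < ratr q < x 0 i + c.
  have [q] := @rat_in_itvoo R (x 0 i - c) (x 0 i + c) ltac:(lra).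
  by rewrite in_itv /= => ?; exists q.
have [q Hq] := choice H.
exists (\row_i q i); apply: (@le_lt_trans _ _ (d%:R * c)).
  apply: enorm_le_coord => i; rewrite !mxE.
  by have /andP[h1 h2] := Hq i; rewrite ler_norml; apply/andP; split; lra.
have -> : eps = d.+1%:R * c by rewrite mulrC divfK // pnatr_eq0.
by rewrite ltr_pM2r // ltr_nat.
Qed.

End Enorm.

Lemma decV_pickle d (v : 'rV[rat]_d) : decV d (pickle v) = v.
Proof.
have -> : decV d (pickle v) = odflt 0 (@unpickle 'rV[rat]_d (pickle v)) by [].
by rewrite pickleK.
Qed.

Lemma decQ_pickle (q : rat) : decQ (pickle q) = q.
Proof.
have -> : decQ (pickle q) = odflt 0 (@unpickle rat (pickle q)) by [].
by rewrite pickleK.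
Qed.

Lemma decB_pickle d (b : 'rV[rat]_d * rat) : decB d (pickle b) = b.
Proof.
have -> : decB d (pickle b) = odflt (0,0) (@unpickle ('rV[rat]_d * rat)%type (pickle b)) by [].
by rewrite pickleK.
Qed.

(** Squaring makes a comparison of Euclidean distances rational; [0 < r] restores the sign that
    squares forget. *)
Definition near_rat d (u v : 'rV[rat]_d) (r : rat) : bool :=
  (0 < r) && (\sum_i (u 0 i - v 0 i) ^+ 2 < r ^+ 2).

Lemma near_ratE d (u v : 'rV[rat]_d) (r : rat) :
  near_rat u v r = (enorm (vratr u - vratr v) < ratr r).
Proof.
rewrite /near_rat; set S := \sum_i _.
have -> : enorm (vratr u - vratr v) = Num.sqrt (ratr S).
  rewrite /enorm /S rmorph_sum; congr Num.sqrt; apply: eq_bigr => i _.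
  by rewrite !mxE rmorphXn rmorphB.
have S0 : 0 <= S by apply: sumr_ge0 => i _; apply: sqr_ge0.
have [r0|r0] := ltP 0 r => /=.
  have r0' : 0 < (ratr r : R) by rewrite ltr0q.
  rewrite -(ltr_rat R) rmorphXn /= -[RHS]ltr_sqr ?nnegrE ?sqrtr_ge0 ?(ltW r0') //.
  by rewrite sqr_sqrtr // ler0q.
apply/esym/negbTE; rewrite -leNgt; apply: le_trans (sqrtr_ge0 _).
by rewrite lerq0.
Qed.

Definition cvec n d (V : (nat -> nat) -> seq nat -> 'rV[rat]_d) :=
  forall i, crat n (fun p a => V p a 0 i).

Lemma crat_sub n Q Q' : crat n Q -> crat n Q' -> crat n (fun p a => Q p a - Q' p a).
Proof. by move=> HQ HQ'; apply: crat_add => //; apply: crat_opp. Qed.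

Lemma cpt_near n d (U V : (nat -> nat) -> seq nat -> 'rV[rat]_d) Q :
  cvec n U -> cvec n V -> crat n Q -> cpt n (fun p a => near_rat (U p a) (V p a) (Q p a)).
Proof.
move=> HU HV HQ; rewrite /near_rat; apply: cpt_and.
  by apply: crat_lt => //; exact: crat_const.
apply: crat_lt; last exact: crat_mul.
apply: (@crat_sum n _ (fun i p a => (U p a 0 i - V p a 0 i) ^+ 2)) => i.
by apply: crat_mul; apply: crat_sub.
Qed.

Definition e2 (k : nat) : rat := (2 ^+ k)^-1.

Lemma ratr_e2 k : ratr (e2 k) = 2 ^- k :> R.
Proof. by rewrite /e2 fmorphV rmorphXn /= ratr_nat. Qed.

Lemma crat_e2 n F : cpt n F -> crat n (fun p a => e2 (F p a)).
Proof.
move=> HF; apply: (@crat_ext _ (fun p a => ((2 ^ F p a)%N%:R)^-1)).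
  by move=> p a _; rewrite natrX.
by apply: crat_inv; solve_cpt.
Qed.

Lemma pow2_gt0 k : 0 < 2 ^- k :> R.
Proof. by rewrite invr_gt0 exprn_gt0. Qed.

Lemma pow2S k : 2 ^- k = 2 * 2 ^- k.+1 :> R.
Proof. by rewrite exprS invfM mulrA divff ?mul1r // pnatr_eq0. Qed.

Lemma pow2_le i j : (i <= j)%N -> 2 ^- j <= 2 ^- i :> R.
Proof.
by move=> le_ij; rewrite lef_pV2 ?posrE ?exprn_gt0 // ler_weXn2l // ler1n.
Qed.

Lemma pow2_small (eps : R) : 0 < eps -> exists k, 2 ^- k < eps.
Proof.
move=> e0; exists (Num.bound eps^-1); rewrite -[ltRHS]invrK ltf_pV2 ?posrE ?invr_gt0 ?exprn_gt0 //.
exact: upper_nthrootP.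
Qed.

(** * Finite prefixes of names of points *)

Definition prefix_ok d (s : seq nat) (x : 'rV[R]_d) :=
  forall i, (i < size s)%N -> enorm (vratr (decV d (nth 0%N s i)) - x) < 2 ^- i.

Lemma rho_exists d (x : 'rV[R]_d) : exists p, rho p x.
Proof.
have H k : exists c, enorm (vratr (decV d c) - x) < 2 ^- k.
  by have [q Hq] := rat_dense x (pow2_gt0 k); exists (pickle q); rewrite decV_pickle.
by have [p Hp] := choice H; exists p.
Qed.

Lemma rho_extend d s (x : 'rV[R]_d) : prefix_ok s x ->
  exists2 p, rho p x & forall i, (i < size s)%N -> p i = nth 0%N s i.
Proof.
move=> Hs; have [p0 Hp0] := rho_exists x.
exists (fun i => if (i < size s)%N then nth 0%N s i else p0 i) => [i|i -> //].
by case: ifP => [/Hs|_]; last exact: Hp0.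
Qed.

Lemma rho_prefix d p (x : 'rV[R]_d) N : rho p x -> prefix_ok (mkseq p N) x.
Proof. by move=> Hp i; rewrite size_mkseq => lt; rewrite nth_mkseq //; apply: Hp. Qed.

(** Only finitely many inequalities are involved, and they are strict. *)
Lemma prefix_open d s (x : 'rV[R]_d) : prefix_ok s x ->
  exists2 r : R, 0 < r & forall y, enorm (y - x) < r -> prefix_ok s y.
Proof.
move=> Hs; suff H N : (N <= size s)%N -> exists2 r : R, 0 < r &
    forall y, enorm (y - x) < r -> forall i, (i < N)%N ->
    enorm (vratr (decV d (nth 0%N s i)) - y) < 2 ^- i by exact: H.
elim: N => [_|N IH lt_N]; first by exists 1.
have [r r0 Hr] := IH (ltnW lt_N); have h := Hs _ lt_N.
set c := vratr _ in h; exists (Num.min r (2 ^- N - enorm (c - x))).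
  by rewrite lt_min r0 subr_gt0.
move=> y; rewrite lt_min => /andP[y1 y2] i; rewrite ltnS leq_eqVlt.
case/orP => [/eqP ->|]; last exact: Hr.
apply: le_lt_trans (enorm_tri x _ _) _; rewrite (enorm_sym x y) -/c; lra.
Qed.

Section Machine.
Variables (n m : nat) (X : set 'rV[R]_n) (f : 'rV[R]_n -> 'rV[R]_m) (e : prf).
Hypothesis He : forall (a : 'rV[R]_n) p, X a -> rho p a ->
  exists q, realizes e p q /\ exists b, b = f a /\ rho q b.

(** The prefix extends to a full name of [x], on which the machine gives this same answer. Since [x]
    is any point admitting the prefix, one run speaks about all of them. *)
Lemma ev_val s x k v : X x -> prefix_ok s x -> ev s e [:: k] = Some v ->
  enorm (vratr (decV m v) - f x) < 2 ^- k.
Proof.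
move=> Xx /rho_extend[p rp Hp] /(ev_sound Hp) cv.
have [q [rq [_ [-> Hq]]]] := He Xx rp.
by rewrite (computes_fun cv (rq k)); apply: Hq.
Qed.

Lemma ev_conv p x k : X x -> rho p x ->
  exists N0, forall N, (N0 <= N)%N -> exists v, ev (mkseq p N) e [:: k] = Some v.
Proof.
move=> Xx rp; have [q [rq _]] := He Xx rp.
by have [N0 H] := computes_ev (rq k); exists N0 => N /H ->; exists (q k).
Qed.

Lemma computable_continuous x (eps : R) : X x -> 0 < eps ->
  exists2 r : R, 0 < r & forall y, X y -> enorm (y - x) < r -> enorm (f y - f x) < eps.
Proof.
move=> Xx e0; have [k Hk] := pow2_small e0.
have [p rp] := rho_exists x; have [N HN] := ev_conv k.+1 Xx rp.
have [v Ev] := HN N (leqnn _); have ok := @rho_prefix _ _ _ N rp.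
have [r r0 Hr] := prefix_open ok; exists r => // y Xy /Hr oky.
have h1 := ev_val Xx ok Ev; have h2 := ev_val Xy oky Ev.
apply: lt_trans Hk; apply: le_lt_trans (enorm_tri (vratr (decV m v)) _ _) _.
rewrite (enorm_sym (f y)) pow2S; lra.
Qed.
End Machine.

(** * Moduli of continuity *)

(* [0] stands for divergence; otherwise the output is shifted by one. *)
Definition run (e : prf) (s : seq nat) (k : nat) : nat := osucc (ev s e [:: k]).

Lemma cpt_run n e S K : cpt n (fun p a => code (S p a)) -> cpt n K ->
  cpt n (fun p a => run e (S p a) (K p a)).
Proof.
move=> HS HK; apply: (@cpt_ev _ e S (fun p a => [:: K p a])) => //.
by apply: (@cpt_cons _ _ (fun _ _ => nil)); solve_cpt.
Qed.

Lemma run_some e s k : run e s k != 0%N -> ev s e [:: k] = Some (run e s k).-1.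
Proof. by rewrite /run; case: ev. Qed.

Lemma run_computes e p N k : run e (mkseq p N) k != 0%N ->
  computes p e [:: k] (run e (mkseq p N) k).-1.
Proof.
move=> /run_some; apply: ev_sound => i; rewrite size_mkseq => lt_i.
by rewrite nth_mkseq.
Qed.

Lemma realizes_run e p q k : realizes e p q ->
  exists N0, forall N, (N0 <= N)%N -> run e (mkseq p N) k = (q k).+1.
Proof.
by move=> /(_ k)/computes_ev[N0 H]; exists N0 => N le_N; rewrite /run H.
Qed.

Lemma realizes_run_all e p q K : realizes e p q ->
  exists N0, forall N, (N0 <= N)%N -> forall k, (k < K)%N -> run e (mkseq p N) k = (q k).+1.
Proof.
move=> H; elim: K => [|K [N1 H1]]; first by exists 0%N.
have [N2 H2] := realizes_run K H; exists (maxn N1 N2) => N.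
rewrite geq_max => /andP[le1 le2] k; rewrite ltnS leq_eqVlt => /orP[/eqP->|].
  exact: H2.
exact: H1.
Qed.

Lemma realizes_run_eq e p q N k : realizes e p q ->
  run e (mkseq p N) k != 0%N -> (run e (mkseq p N) k).-1 = q k.
Proof. by move=> H /run_computes c; apply: computes_fun c (H k). Qed.

Lemma cnth_code s i : cnth (code s) i = nth 0%N s i.
Proof. by rewrite /cnth codeK. Qed.

Lemma cpt_prefix n N : cpt n N -> cpt n (fun p a => code (mkseq p (N p a))).
Proof. by apply: (@cpt_mkseq _ (fun p a i => p i)); solve_cpt. Qed.

(** A witness holds the length of a prefix of [p] and the number of entries of [q] computed from it;
    the second machine is then run on these entries. *)
Lemma realizes_comp e1 e2 : exists e, forall p q r,
  realizes e1 p q -> realizes e2 q r -> realizes e p r.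
Proof.
pose s p w := mkseq (fun i => (run e1 (mkseq p (cnth w 0)) i).-1) (cnth w 1).
pose C p w (k : nat) := all (fun i => run e1 (mkseq p (cnth w 0)) i != 0%N)
   (iota 0 (cnth w 1)) && (run e2 (s p w) k != 0%N).
pose O p w (k : nat) := (run e2 (s p w) k).-1.
have Hs : cpt 2 (fun p a => code (s p (nth 0%N a 0))).
  apply: (@cpt_mkseq _ (fun p a i => (run e1 (mkseq p (cnth (nth 0%N a 0) 0)) i).-1)); solve_cpt.
  by apply: cpt_run; solve_cpt; apply: cpt_prefix; solve_cpt.
have HC : cpt 2 (fun p a => C p (nth 0%N a 0) (nth 0%N a 1)).
  rewrite /C; solve_cpt; last by apply: cpt_run; solve_cpt.
  apply: (@cpt_all _ (fun p a i => run e1 (mkseq p (cnth (nth 0%N a 0) 0)) i != 0%N)); solve_cpt.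
  by apply: cpt_run; solve_cpt; apply: cpt_prefix; solve_cpt.
have HO : cpt 2 (fun p a => O p (nth 0%N a 0) (nth 0%N a 1)).
  by rewrite /O; solve_cpt; apply: cpt_run; solve_cpt.
have [e He] := realizes_search HC HO.
exists e => p q r H1 H2.
have ex k : exists w, C p w k.
  have [N2 E2] := realizes_run k H2; have [N1 E1] := realizes_run_all N2 H1.
  exists (code [:: N1; N2]); rewrite /C /s !cnth_code /=; apply/andP; split.
    by apply/allP => i; rewrite mem_iota /= add0n => lt_i; rewrite E1.
  suff -> : mkseq (fun i => (run e1 (mkseq p N1) i).-1) N2 = mkseq q N2 by rewrite E2.
  by apply/eq_in_map => i; rewrite mem_iota /= add0n => lt_i; rewrite E1.
have [t [Ht1 Ht2]] := He p ex.
suff <- : t = r by [].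
apply: funext => k; have [w /andP[Ca Cr] ->] := Ht2 k; rewrite /O.
have sE : s p w = mkseq q (cnth w 1).
  apply/eq_in_map => i i_in; have := allP Ca i i_in; exact: realizes_run_eq.
by move: Cr; rewrite sE; apply: realizes_run_eq.
Qed.

Local Open Scope classical_set_scope.

Section ModulusOfContinuity.
Variables (n m : nat) (X : set 'rV[R]_n) (f : 'rV[R]_n -> 'rV[R]_m).

Lemma prod_rep_even (x : 'rV[R]_n) k r : prod_rep (@rho n) nu r (x, k) ->
  rho (fun i => r (2 * i)%N) x /\ r 1%N = k.
Proof. by []. Qed.

(* The name of [x] is shifted by one so that every entry has some slack: its
   prefix of length [w] is then also a prefix of a name of each point at
   distance less than [2 ^- w.+1] from [x]. *)
Lemma computable_moc : computable_on X f ->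
  mv_computable (prod_rep (@rho n) nu) nu [set xk | X (fst xk)]
    (fun xk l => f @` (eball xk.1 (2 ^- l) `&` X) `<=` eball (f xk.1) (2 ^- xk.2)).
Proof.
move=> [ef Hf].
pose s (r : nat -> nat) w := mkseq (fun i => r (2 * i.+1)%N) w.
pose C r w (k : nat) := run ef (s r w) (r 1%N).+1 != 0%N.
have HC : cpt 2 (fun p a => C p (nth 0%N a 0) (nth 0%N a 1)).
  rewrite /C; solve_cpt; apply: cpt_run; solve_cpt.
  by apply: (@cpt_mkseq _ (fun p a i => p (2 * i.+1)%N)); solve_cpt.
have HO : cpt 2 (fun p a => (nth 0%N a 0).+1) by solve_cpt.
have [e He] := @realizes_search C (fun _ w _ => w.+1) HC HO.
exists e => -[x k] r /= Xx /prod_rep_even[rx rk].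
have rx' : rho (fun i => r (2 * i.+1)%N) x.
  by move=> i; apply: lt_le_trans (rx i.+1) _; exact: pow2_le.
have [|q [rq Hq]] := He r.
  move=> k0; have [N H] := ev_conv Hf k.+1 Xx rx'; have [v Ev] := H N (leqnn _).
  by exists N; rewrite /C /s rk /run Ev.
exists q; split=> //; exists (q 0%N); split=> //.
have [w Cw ->] := Hq 0%N; rewrite /C rk in Cw.
move=> _ [y [yx Xy] <-]; rewrite /eball /=.
have ok z : enorm (z - x) < 2 ^- w.+1 -> prefix_ok (s r w) z.
  move=> Hz i; rewrite size_mkseq => lt_i; rewrite nth_mkseq //.
  apply: le_lt_trans (enorm_tri x _ _) _; rewrite pow2S (enorm_sym x).
  have := rx i.+1; have := @pow2_le i.+1 w.+1 (ltnW lt_i); lra.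
have Ev := run_some Cw.
have h1 := ev_val Hf Xy (ok y yx) Ev.
have h2 : enorm (vratr (decV m (run ef (s r w) k.+1).-1) - f x) < 2 ^- k.+1.
  by apply: (ev_val Hf Xx _ Ev); apply: ok; rewrite subrr enorm0 pow2_gt0.
apply: le_lt_trans (enorm_tri (vratr (decV m (run ef (s r w) k.+1).-1)) _ _) _.
rewrite (enorm_sym (f y)) pow2S; lra.
Qed.
End ModulusOfContinuity.

Lemma cpt_half n F : cpt n F -> cpt n (fun p a => (F p a)./2).
Proof.
apply: (cpt_app1 (h := half)).
apply: (@cpt_ext _ (fun p b => prec 0%N (fun i r => if odd i then r.+1 else r) (nth 0%N b 0))).
  move=> p b _; elim: (nth 0%N b 0) => //= k ->.
  by rewrite uphalf_half; case: (odd k).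
by apply: (@cpt_prec _ _ (fun _ _ i r => if odd i then r.+1 else r)); solve_cpt.
Qed.

(** The interleaving that [prod_rep] expects, with the constant name of [k]. *)
Definition join (p : nat -> nat) (k i : nat) : nat := if odd i then k else p i./2.

Lemma prod_rep_join n p (x : 'rV[R]_n) k : rho p x ->
  prod_rep (@rho n) nu (join p k) (x, k).
Proof.
move=> rp; split; last by [].
by move=> i /=; rewrite /join mul2n odd_double doubleK; apply: rp.
Qed.

Lemma cpt_cseq n J N : cpt n J -> cpt n N ->
  cpt n (fun p a => code (mkseq (fun _ => J p a) (N p a))).
Proof.
move=> HJ HN; apply: (@cpt_mkseq _ (fun p a _ => J p a)) => //.
exact: cpt_behead.
Qed.

(** Error budget of the search below. A point [xs j] within [2 ^- l.+3] of [x], with both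
    approximated to that precision, passes a test with threshold [2 ^- l.+1]; conversely, by the
    next lemma, passing the test puts [xs j] within [2 ^- l] of [x]. *)
Lemma pow2_sum3 l : 2 ^- l.+3 + (2 ^- l.+3 + 2 ^- l.+3) <= 2 ^- l.+1 :> R.
Proof. by have := pow2_gt0 l.+3; rewrite (pow2S l.+1) (pow2S l.+2); lra. Qed.

Lemma pow2_sum8 l : 2 ^- l.+3 + (2 ^- l.+1 + 2 ^- l.+3) <= 2 ^- l :> R.
Proof. by have := pow2_gt0 l.+3; rewrite (pow2S l) (pow2S l.+1) (pow2S l.+2); lra. Qed.

(** * Computability from a dense sequence and a modulus of continuity *)

Section FromModulus.
Variables (n m : nat) (X : set 'rV[R]_n) (f : 'rV[R]_n -> 'rV[R]_m).
Variable xs : nat -> 'rV[R]_n.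

Lemma computable_seq_image : computable_on X f -> computable_seq xs ->
  (forall j, X (xs j)) -> computable_seq (fun j => f (xs j)).
Proof.
move=> [ef Hf] [ex Hx] Xxs; have [e He] := realizes_comp ex ef.
exists e => j p _ pj; have [q [rq [_ [-> xq]]]] := Hx j p I pj.
have [t [rt [_ [-> ft]]]] := Hf _ _ (Xxs j) xq.
by exists t; split; [exact: He rq rt|exists (f (xs j))].
Qed.

Lemma computable_of_moc (moc : 'rV[R]_n * nat -> nat -> Prop) :
  computable_seq xs -> dense_seq_in xs X -> computable_seq (fun j => f (xs j)) ->
  mv_computable (prod_rep (@rho n) nu) nu [set xk | X (fst xk)] moc ->
  (forall (x : 'rV[R]_n) (k l : nat), X x -> moc (x, k) l ->
            f @` (eball x (2 ^- l) `&` X) `<=` eball (f x) (2 ^- k)) ->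
  computable_on X f.
Proof.
move=> [ex Hx] [Xxs dense] [ef Hf] [em Hm] moc_sound.
(* The witness lists the run length for the modulus, the index [j], and the run lengths for [xs j]
   and [f (xs j)]. As [run] shifts its value, [L] is [l.+1], so precision [L.+2] means [l.+3].
   Asking for [k.+1] leaves half of the error for approximating [f (xs j)]. *)
pose L p w k := run em (mkseq (join p k.+1) (cnth w 0)) 0.
pose U p w k := run ex (mkseq (fun _ => cnth w 1) (cnth w 2)) (L p w k).+2.
pose V w k := run ef (mkseq (fun _ => cnth w 1) (cnth w 3)) k.+1.
pose C p w k := [&& L p w k != 0%N, U p w k != 0%N, V w k != 0%N &
  near_rat (decV n (U p w k).-1) (decV n (p (L p w k).+2)) (e2 (L p w k))].
have HL : cpt 2 (fun p a => L p (nth 0%N a 0) (nth 0%N a 1)).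
  apply: cpt_run; solve_cpt.
  apply: (@cpt_mkseq _ (fun p a i => join p (nth 0%N a 1).+1 i)); solve_cpt.
  by rewrite /join; solve_cpt; apply: cpt_half; solve_cpt.
have HU : cpt 2 (fun p a => U p (nth 0%N a 0) (nth 0%N a 1)).
  by apply: cpt_run; solve_cpt; apply: cpt_cseq; solve_cpt.
have HV : cpt 2 (fun p a => V (nth 0%N a 0) (nth 0%N a 1)).
  by apply: cpt_run; solve_cpt; apply: cpt_cseq; solve_cpt.
have HC : cpt 2 (fun p a => C p (nth 0%N a 0) (nth 0%N a 1)).
  rewrite /C; solve_cpt; apply: cpt_near; last by apply: crat_e2; solve_cpt.
    by move=> i; apply: crat_decV; solve_cpt.
  by move=> i; apply: crat_decV; solve_cpt.
have [|e He] := @realizes_search C (fun _ w k => (V w k).-1) HC; first by solve_cpt.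
exists e => x p Xx rp.
have mocE k : exists2 q, realizes em (join p k) q & moc (x, k) (q 0%N).
  have [q [rq [l [ml ql]]]] := Hm (x, k) (join p k) Xx (prod_rep_join k rp).
  by exists q; rewrite // ql.
have seqE (e' : prf) d (g : nat -> 'rV[R]_d) j :
    (forall (a : nat) (p0 : nat -> nat), [set: nat] a -> nu p0 a ->
       exists q, realizes e' p0 q /\ exists b, b = g a /\ rho q b) ->
    exists2 q, realizes e' (fun _ => j) q & rho q (g j).
  by move=> H; have [q [rq [_ [-> ?]]]] := H j (fun _ => j) I erefl; exists q.
have [|q [rq Hq]] := He p.
  move=> k; have [q rq ml] := mocE k.+1; set l := q 0%N in ml.
  have [j Hj] := dense x Xx (2 ^- l.+3) (pow2_gt0 _).
  have [u ru rhou] := seqE _ _ _ j Hx; have [v rv rhov] := seqE _ _ _ j Hf.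
  have [N0 /(_ _ (leqnn _)) E0] := realizes_run 0 rq.
  have [N1 /(_ _ (leqnn _)) E1] := realizes_run l.+3 ru.
  have [N2 /(_ _ (leqnn _)) E2] := realizes_run k.+1 rv.
  exists (code [:: N0; j; N1; N2]).
  rewrite /C /U /V /L !cnth_code /= E0 -/l E1 E2 /= near_ratE ratr_e2.
  have h : enorm (x - vratr (decV n (p l.+3))) < 2 ^- l.+3.
    by rewrite enorm_sym; exact: rp.
  apply: lt_le_trans (enorm_tri_lt (rhou l.+3) (enorm_tri_lt Hj h)) _.
  exact: pow2_sum3.
exists q; split=> //; exists (f x); split=> // k.
have [w /and4P[CL CU CV near] ->] := Hq k.
have [qm rqm ml] := mocE k.+1; set j := cnth w 1.
have [u ru rhou] := seqE _ _ _ j Hx; have [v rv rhov] := seqE _ _ _ j Hf.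
(* Runs on the same name agree, so the modulus value inside the witness is one that [moc] admits. *)
have LE := realizes_run_eq rqm CL; have UE := realizes_run_eq ru CU.
have VE := realizes_run_eq rv CV.
move: near; rewrite near_ratE ratr_e2 /U UE.
have -> : L p w k = (qm 0%N).+1 by rewrite -LE prednK // lt0n.
set l := qm 0%N in ml *; rewrite /V VE => near.
have jx : enorm (xs j - x) < 2 ^- l.
  have h : enorm (xs j - vratr (decV n (u l.+3))) < 2 ^- l.+3.
    by rewrite enorm_sym; exact: rhou.
  apply: lt_le_trans (enorm_tri_lt h (enorm_tri_lt near (rp l.+3))) _.
  exact: pow2_sum8.
have fjx : enorm (f (xs j) - f x) < 2 ^- k.+1.
  by apply: (moc_sound x k.+1 l Xx ml); exists (xs j).
rewrite pow2S mulr_natl mulr2n.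
exact: enorm_tri_lt (rhov k.+1) fjx.
Qed.
End FromModulus.

Lemma pow2_sum2 l : 2 ^- l.+1 + 2 ^- l.+2 < 2 ^- l :> R.
Proof. by have := pow2_gt0 l.+2; rewrite (pow2S l) (pow2S l.+1); lra. Qed.

Lemma rho_const n (x : 'rV[rat]_n) c : decV n c = x -> rho (fun _ => c) (vratr x).
Proof. by move=> cx k; rewrite cx subrr enorm0 pow2_gt0. Qed.

Lemma eball_sub d (c x : 'rV[R]_d) (r s : R) : enorm (x - c) < r - s ->
  eball x s `<=` eball c r.
Proof.
move=> xc y yx; rewrite /eball /=.
by have := enorm_tri_lt yx xc; rewrite [ltRHS]addrC subrK.
Qed.

(** * Openness from a modulus of openness *)

(** Filler for the entries of a [theta_lt] name whose check fails: radius 0 adds nothing to the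
    union. *)
Definition empty_ball d : nat := pickle (0 : 'rV[rat]_d, 0 : rat).

Lemma eball_empty_ball d :
  eball (vratr (decB d (empty_ball d)).1) (ratr (decB d (empty_ball d)).2) = set0.
Proof.
rewrite /empty_ball decB_pickle /= rmorph0 -subset0 => y.
by rewrite /eball /= ltNge enorm_ge0.
Qed.

Lemma vratr_inj d (u v : 'rV[rat]_d) : (forall i, u 0 i == v 0 i) -> u = v.
Proof. by move=> H; apply/rowP => i; apply/eqP. Qed.

Section MooToOpen.
Variables (n m : nat) (X : set 'rV[R]_n) (f : 'rV[R]_n -> 'rV[R]_m).
Variable moo : 'rV[R]_n * nat -> nat -> Prop.
Hypothesis moo_sound : forall (x : 'rV[R]_n) (k l : nat), X x -> moo (x, k) l ->
  eball (f x) (2 ^- l) `<=` f @` (eball x (2 ^- k) `&` X).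

(* An output index codes a ball to be listed, the centre [x], the radius
   exponent [k], the index of a ball of [U] around [B(x, 2^-k)], a prefix of a
   name of [x], and the length of the prefix of the constant name of [x] on
   which [f] is run. *)
Lemma eff_open_of_moo : computable_on X f ->
  mv_computable (prod_rep (@rho n) nu) nu [set xk | X (fst xk)] moo ->
  eff_open X f.
Proof.
move=> [ef Hf] [em Hm].
pose sg j := decode (cnth j 4).
pose S j := mkseq (fun t => if odd t then cnth j 2 else nth 0%N (sg j) t./2)
                  (2 * size (sg j)).
pose L j := run em (S j) 0.
pose V j := run ef (mkseq (fun _ => cnth j 1) (cnth j 5)) (L j).+1.
pose x j := decV n (cnth j 1).
(* With [L j = l.+1], the listed ball has radius [2 ^- l.+1] and a centre within [2 ^- l.+2] of
   [f x], so it stays inside the ball of radius [2 ^- l] around [f x]. *)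
pose C (p : nat -> nat) j := [&& L j != 0%N, V j != 0%N,
  near_rat (x j) (decB n (p (cnth j 3))).1
    ((decB n (p (cnth j 3))).2 - e2 (cnth j 2)),
  all (fun t => near_rat (decV n (nth 0%N (sg j) t)) (x j) (e2 t)) (iota 0 (size (sg j))),
  [forall i, (decB m (cnth j 0)).1 0 i == decV m (V j).-1 0 i] &
  (decB m (cnth j 0)).2 == e2 (L j)].
pose O p j := if C p j then cnth j 0 else empty_ball m.
have [|e He] := @realizes_total O.
  have HS : cpt 1 (fun (_ : nat -> nat) a => code (S (nth 0%N a 0))).
    apply: (@cpt_mkseq _ (fun _ a t => if odd t then cnth (nth 0%N a 0) 2
      else nth 0%N (sg (nth 0%N a 0)) t./2)); rewrite /sg; solve_cpt.
    by apply: cpt_nthl; [apply: cpt_half|apply: cpt_decode]; solve_cpt.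
  have HL : cpt 1 (fun (_ : nat -> nat) a => L (nth 0%N a 0)) by apply: cpt_run; solve_cpt.
  have HV : cpt 1 (fun (_ : nat -> nat) a => V (nth 0%N a 0)).
    by apply: cpt_run; solve_cpt; apply: cpt_cseq; solve_cpt.
  rewrite /O; solve_cpt; rewrite /C; solve_cpt.
  - apply: cpt_near => [i|i|]; first by apply: crat_decV; solve_cpt.
      by apply: crat_decB1; solve_cpt.
    by apply: crat_sub; [apply: crat_decB2|apply: crat_e2]; solve_cpt.
  - apply: (@cpt_all _ (fun _ a t => near_rat (decV n (nth 0%N (sg (nth 0%N a 0)) t))
      (x (nth 0%N a 0)) (e2 t))); rewrite /sg; solve_cpt.
    apply: cpt_near => [i|i|]; last by apply: crat_e2; solve_cpt.
      by apply: crat_decV; apply: cpt_nthl; solve_cpt; apply: cpt_decode; solve_cpt.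
    by apply: crat_decV; solve_cpt.
  - apply: (@cpt_forall _ _ (fun i p a => (decB m (cnth (nth 0%N a 0) 0)).1 0 i
      == decV m (V (nth 0%N a 0)).-1 0 i)) => i.
    by apply: crat_eq; [apply: crat_decB1|apply: crat_decV]; solve_cpt.
  - by apply: crat_eq; [apply: crat_decB2|apply: crat_e2]; solve_cpt.
exists e => U p [openU UX] pU; exists (O p); split; first exact: He.
exists (f @` U); split=> //; rewrite /theta_lt; apply/seteqP; split=> y; last first.
  move=> [j _]; rewrite /O; case: ifP => [|_]; last by rewrite eball_empty_ball.
  case/and5P=> CL CV; rewrite near_ratE rmorphB /= ratr_e2 => xc /allP ok /andP[/forallP bV /eqP br].
  set k := cnth j 2 in xc; set xj := vratr (x j) in xc.
  have ballU : eball xj (2 ^- k) `<=` U.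
    by rewrite pU => z zx; exists (cnth j 3) => //; exact: eball_sub zx.
  have Xx : X xj by apply: UX; apply: ballU; rewrite /eball /= subrr enorm0 pow2_gt0.
  have oks : prefix_ok (sg j) xj.
    move=> t lt_t; have := ok t; rewrite mem_iota /= add0n lt_t near_ratE ratr_e2.
    exact.
  (* The modulus is guaranteed on full names only, so the recorded prefix is completed to a name of
     [xj]; the run sees nothing beyond the prefix. *)
  have [p0 rp0 p0E] := rho_extend oks.
  have [q [rq [l [ml ql]]]] := Hm (xj, k) (join p0 k) Xx (prod_rep_join k rp0).
  have lE : (L j).-1 = l.
    rewrite -ql; apply: computes_fun (rq 0%N); apply: ev_sound (run_some CL) => t.
    rewrite size_mkseq => lt_t; rewrite nth_mkseq // /join; case: ifP => // _.
    by rewrite p0E // ltn_half_double -mul2n.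
  have LE : L j = l.+1 by rewrite -lE prednK // lt0n.
  have vE : enorm (vratr (decV m (V j).-1) - f xj) < 2 ^- l.+2.
    rewrite -LE; apply: (ev_val Hf Xx _ (run_some CV)).
    by apply: rho_prefix; apply: rho_const.
  rewrite (vratr_inj bV) br ratr_e2 LE /eball /= => yb.
  have : eball (f xj) (2 ^- l) y.
    exact: lt_trans (enorm_tri_lt yb vE) (pow2_sum2 l).
  by move=> /(moo_sound Xx ml)[z [zx _] <-]; exists z => //; apply: ballU.
move=> [x0 Ux0 <-].
have : U x0 by []. rewrite pU => -[i _]; rewrite /eball /=.
set c := vratr _; set r := ratr _ => x0c.
(* Half of the room: one [2 ^- k] for moving from [x0] to a rational point, one for the ball around
   that point. *)
have [k Hk] := @pow2_small ((r - enorm (x0 - c)) / 2) ltac:(lra).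
have X0 := UX _ Ux0; have [p0 rp0] := rho_exists x0.
have [q [rq [l [ml ql]]]] := Hm (x0, k) (join p0 k) X0 (prod_rep_join k rp0).
have [N0 HN0] := realizes_run 0 rq.
(* The interleaved name is cut at [2 * N0], which corresponds to [N0] entries of [p0]. *)
have {}HN0 := HN0 (2 * N0)%N (@leq_pmull N0 2 isT).
(* Within [r1] of [x0] every point admits this prefix and hence the same [l]. As [l] is fixed before
   the rational point [xq] is chosen, [xq] can be taken so close that [f x0] falls into the ball
   listed for [xq]. *)
have [r1 r10 Hr1] := prefix_open (@rho_prefix _ _ _ N0 rp0).
have [r2 r20 Hr2] := computable_continuous Hf X0 (pow2_gt0 l.+2).
have [xq Hxq] := @rat_dense _ x0 (Num.min (Num.min r1 r2) (2 ^- k))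
  ltac:(by rewrite !lt_min r10 r20 pow2_gt0).
move: Hxq; rewrite !lt_min => /andP[/andP[xr1 xr2] xk].
have xc : enorm (vratr xq - c) < r - 2 ^- k.
  apply: lt_le_trans (enorm_tri_lt xk (_ : _ < r - 2 ^- k - 2 ^- k)) _; lra.
have Uxq : U (vratr xq).
  by rewrite pU; exists i => //; rewrite /eball /= -/c -/r; have := pow2_gt0 k; lra.
have [qx [rqx [_ [-> qxE]]]] := Hf _ _ (UX _ Uxq) (rho_const (decV_pickle xq)).
have [N1 /(_ _ (leqnn _)) HN1] := realizes_run l.+2 rqx.
pose v := qx l.+2; pose b := pickle (decV m v, e2 l.+1).
pose j := code [:: b; pickle xq; k; i; code (mkseq p0 N0); N1].
have sgE : sg j = mkseq p0 N0 by rewrite /sg /j cnth_code /= codeK.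
have LE : L j = l.+1.
  rewrite /L -ql -HN0; congr run; rewrite /S sgE size_mkseq /j !cnth_code /=.
  apply/eq_in_map => t; rewrite mem_iota /= add0n /join => lt_t; case: ifP => // _.
  by rewrite nth_mkseq // ltn_half_double -mul2n.
have VE : V j = v.+1 by rewrite /V LE /j !cnth_code.
have Cj : C p j.
  rewrite /C LE VE sgE /x /j !cnth_code /= decV_pickle decB_pickle /= eqxx andbT.
  apply/and3P; split.
  - by rewrite near_ratE rmorphB /= ratr_e2.
  - apply/allP => t; rewrite mem_iota /= add0n size_mkseq => lt_t.
    by rewrite near_ratE ratr_e2; apply: (Hr1 _ xr1); rewrite size_mkseq.
  - by apply/forallP => s.
exists j => //; rewrite /O Cj /j cnth_code /= decB_pickle /= ratr_e2 /eball /= enorm_sym.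
rewrite pow2S mulr_natl mulr2n; apply: enorm_tri_lt (qxE l.+2) _.
by apply: Hr2 => //; exact: UX.
Qed.
End MooToOpen.

(** Any [l] with [2 ^- l] below some listed rational will do, and positivity of [Moo] makes the
    search for it terminate. *)
Lemma moo_of_Moo n m (X : set 'rV[R]_n) (f : 'rV[R]_n -> 'rV[R]_m) :
  (forall (x : 'rV[R]_n) (k : nat), X x -> (0 < Moo X f x k)%E) ->
  fun_computable (prod_rep (@rho n) nu) rho_lt [set xk | X (fst xk)]
         (fun xk => Moo X f (fst xk) (snd xk)) ->
  mv_computable (prod_rep (@rho n) nu) nu [set xk | X (fst xk)]
    (fun xk l => eball (f xk.1) (2 ^- l) `<=` f @` (eball xk.1 (2 ^- xk.2) `&` X)).
Proof.
move=> Moo0 [eM HM].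
pose A r w := run eM (mkseq r (cnth w 0)) (cnth w 1).
pose C r w (k : nat) := (A r w != 0%N) && (e2 (cnth w 2) < decQ (A r w).-1).
have HA : cpt 2 (fun r a => A r (nth 0%N a 0)).
  by apply: cpt_run; solve_cpt; apply: cpt_prefix; solve_cpt.
have HC : cpt 2 (fun p a => C p (nth 0%N a 0) (nth 0%N a 1)).
  by rewrite /C; solve_cpt; apply: crat_lt; [apply: crat_e2|apply: crat_decQ]; solve_cpt.
have [|e He] := @realizes_search C (fun _ w _ => cnth w 2) HC; first by solve_cpt.
exists e => -[x k] r /= Xx rxk.
have [q [rq [_ [-> qM]]]] := HM (x, k) r Xx rxk.
have [|t [rt Ht]] := He r.
  move=> k0; have := Moo0 x k Xx; rewrite -qM => /ereal_sup_gt[_ [i _ <-]].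
  rewrite lte_fin => /pow2_small[l Hl].
  have [N /(_ _ (leqnn _)) HN] := realizes_run i rq.
  exists (code [:: N; i; l]); rewrite /C /A !cnth_code /= HN /=.
  by rewrite -(ltr_rat R) ratr_e2.
exists t; split=> //; exists (t 0%N); split=> //.
have [w /andP[CA] lt_w ->] := Ht 0%N; set l := cnth w 2 in lt_w *.
have : ((2 ^- l)%:E < Moo X f x k)%E.
  rewrite -qM; apply: (@lt_le_trans _ _ (ratr (decQ (A r w).-1))%:E).
    by rewrite lte_fin -ratr_e2 ltr_rat.
  apply: ereal_sup_ubound; exists (cnth w 1) => //=.
  by congr (ratr (decQ _))%:E; rewrite -(realizes_run_eq rq CA).
move=> /ereal_sup_gt[_ [s [s0 sub] <-]]; rewrite lte_fin => ls y yb.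
by apply: sub; apply: ltW; apply: lt_trans ls.
Qed.

(** * Lower computability of Moo *)

(** Bolzano-Weierstrass, from compactness of a product of segments. The coordinatewise form is
    carried over to [enorm] by [enorm_le_coord]. *)
Lemma bounded_seq_cluster (K : realType) d (y : nat -> 'rV[K]_d) (B : K) :
  (forall n i, `|y n 0 i| <= B) ->
  exists z : 'rV[K]_d, forall eps : K, 0 < eps -> forall N,
    exists2 n, (N <= n)%N & forall i, `|y n 0 i - z 0 i| < eps.
Proof.
move=> Hy; pose A := [set v : 'rV[K]_d | forall i, `[- B, B]%classic (v ord0 i)].
have cA : compact A.
  by apply: (@rV_compact K _ (fun=> `[- B, B]%classic)) => i; exact: segment_compact.
have F : ProperFilter (y @ \oo) by apply: fmap_proper_filter.
have [|z [Az clz]] := cA (y @ \oo) F.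
  by exists 0%N => // n _ i; rewrite /= in_itv /= -ler_norml; exact: Hy.
exists z => eps e0 N.
have [|v [[n /= le_n <-] yz]] := clz (y @` [set n | (N <= n)%N]) (ball z eps) _ (nbhsx_ballx _ _ e0).
  by exists N => // n /= le_n; exists n.
exists n => // i; case: yz => _ /(_ ord0 i).
by rewrite -ball_normE /= distrC.
Qed.

(** One argument gives both the finite subcover and the margin. Otherwise, for each [N], some point
    of the closed ball is missed by the first [N] balls up to [2 ^- N]; a cluster point of these
    lies inside some ball with room to spare, and so do points arbitrarily late in the sequence. *)
Lemma lebesgue_number d (y0 : 'rV[R]_d) (s : R) (c : nat -> 'rV[R]_d) (r : nat -> R) :
  ecball y0 s `<=` \bigcup_(j in [set: nat]) eball (c j) (r j) ->
  exists N eps, 0 < eps /\ forall y, ecball y0 s y ->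
    exists2 j, (j < N)%N & enorm (y - c j) + eps < r j.
Proof.
move=> cover; apply: contrapT => H.
have {}H N : exists y, ecball y0 s y /\
    forall j, (j < N)%N -> r j <= enorm (y - c j) + 2 ^- N.
  apply: contrapT => H'; apply: H; exists N, (2 ^- N); split; first exact: pow2_gt0.
  move=> y Ky; apply: contrapT => Hy; apply: H'; exists y; split=> // j lt_j.
  by rewrite leNgt; apply/negP => h; apply: Hy; exists j.
have [y Hy] := choice H.
have s0 : 0 <= s by apply: le_trans (enorm_ge0 _) (Hy 0%N).1.
have [|z Hz] := @bounded_seq_cluster R d y (s + enorm y0).
  move=> N i; have -> : y N 0 i = (y N - y0) 0 i + y0 0 i by rewrite !mxE subrK.
  apply: le_trans (ler_normD _ _) (lerD _ (coord_le_enorm _ _)).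
  exact: le_trans (coord_le_enorm _ _) (Hy N).1.
have {}Hz (eps : R) N : 0 < eps -> exists2 n, (N <= n)%N & enorm (y n - z) < eps.
  move=> e0; have [|n le_n Hn] := Hz (eps / d.+1%:R) _ N; first by rewrite divr_gt0 ?ltr0n.
  exists n => //; apply: (@le_lt_trans _ _ (d%:R * (eps / d.+1%:R))).
    by apply: enorm_le_coord => i; rewrite !mxE; apply: ltW; exact: Hn.
  have -> : d%:R * (eps / d.+1%:R) = eps * (d%:R / d.+1%:R) by ring.
  by rewrite gtr_pMr // ltr_pdivrMr ?ltr0n // mul1r ltr_nat.
have Kz : ecball y0 s z.
  rewrite /ecball /= leNgt; apply/negP => lt_s.
  have [|n _ Hn] := Hz (enorm (z - y0) - s) 0%N; first by rewrite subr_gt0.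
  have := enorm_tri (y n) z y0; have := (Hy n).1; rewrite /ecball /= => h1.
  rewrite (enorm_sym z (y n)) => h2.
  by move: Hn h1 h2; move: (enorm _) (enorm _) (enorm _) => a b e; lra.
have [j _ zj] := cover _ Kz; rewrite /eball /= in zj.
pose g := (r j - enorm (z - c j)) / 2; have g0 : 0 < g by rewrite divr_gt0 // subr_gt0.
have [k Hk] := pow2_small g0.
have [n le_n Hn] := Hz g (maxn k j.+1) g0.
move: le_n; rewrite geq_max => /andP[le_k lt_j].
have := (Hy n).2 j lt_j; apply/negP; rewrite -ltNge.
have h1 := enorm_tri z (y n) (c j); have h2 := pow2_le le_k.
move: h1 h2 Hk Hn; rewrite /g.
move: (enorm (z - c j)) (enorm (y n - c j)) (enorm (y n - z)) (2 ^- n) (2 ^- k) (r j).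
by move=> a b a' b' c' d'; lra.
Qed.

(** * A decidable grid test for the covering of a closed ball *)

Fixpoint all_digits (m B : nat) (P : pred (seq nat)) (t : seq nat) : bool :=
  if m is m'.+1 then all (fun x => all_digits m' B P (x :: t)) (iota 0 B) else P t.

Lemma all_digitsP m B (P : pred (seq nat)) t : reflect
  (forall s, size s = m -> all (fun x => x < B)%N s -> P (s ++ t)) (all_digits m B P t).
Proof.
elim: m t => [|m IH] t /=.
  by apply: (iffP idP) => [Pt [|]|/(_ [::])] //; apply.
apply: (iffP allP) => [H s|H x].
  case/lastP: s => [//|s x]; rewrite size_rcons all_rcons => -[sm] /andP[xB sB].
  have := H x; rewrite mem_iota /= add0n => /(_ xB)/IH/(_ s sm sB).
  by rewrite cat_rcons.
rewrite mem_iota /= add0n => xB; apply/IH => s sm sB.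
by rewrite -cat_rcons; apply: H; rewrite ?size_rcons ?sm // all_rcons xB.
Qed.

Lemma cpt_dropF k n F : cpt n F -> cpt (k + n) (fun p a => F p (drop k a)).
Proof.
elim: k => [|k IH] HF.
  by apply: cpt_ext HF => p a _; rewrite drop0.
have := cpt_behead (IH HF); apply: cpt_ext => p a _.
by rewrite -drop1 drop_drop addn1.
Qed.

(** The dimension [m] is fixed, so the nested loops unfold into [m] uses of [cpt_all]; the first [l]
    arguments are the digits chosen so far. *)
Lemma cpt_all_digits n m B (P : (nat -> nat) -> seq nat -> pred (seq nat)) :
  cpt (m + n) (fun p a => P p (drop m a) (take m a)) -> cpt n B ->
  cpt n (fun p a => all_digits m (B p a) (P p a) [::]).
Proof.
move=> HP HB; suff H k l : (k + l)%N = m ->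
    cpt (l + n) (fun p a => all_digits k (B p (drop l a)) (P p (drop l a)) (take l a)).
  by apply: cpt_ext (H m 0%N _) => [p a _|]; rewrite ?addn0 // drop0 take0.
elim: k l => [|k IH] l kl.
  by rewrite add0n in kl; rewrite -kl in HP.
apply: (@cpt_all _ (fun p a x => all_digits k (B p (drop l a)) (P p (drop l a)) (x :: take l a)));
  last exact: cpt_dropF.
have := IH l.+1; rewrite addnS => /(_ kl).
by apply: cpt_ext => p [|x a] //=; rewrite -addSn.
Qed.

(** The digit is the integer part of [u / h]. It equals [L.+1] at the right end, hence the bound
    [L.+2]. *)
Lemma grid_digit (S h u : R) L : 0 < S -> h = S * 2 / L.+1%:R -> 0 <= u <= S * 2 ->
  exists2 t, (t < L.+2)%N & `|u - t%:R * h| <= h.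
Proof.
move=> S0 hE /andP[u0 uS]; have L0 : 0 < L.+1%:R :> R by rewrite ltr0n.
have h0 : 0 < h by rewrite hE divr_gt0 // mulr_gt0.
have uh0 : 0 <= u / h by rewrite divr_ge0 // ltW.
have /andP[h1 h2] := truncn_itv uh0; set t := Num.truncn _ in h1 h2.
exists t.
  rewrite ltnS -(ler_nat R) (le_trans h1) // ler_pdivrMr // hE.
  by rewrite mulrC divfK ?gt_eqF.
move: h1 h2; rewrite ler_pdivlMr // ltr_pdivrMr // -natr1 mulrDl mul1r => h1 h2.
by rewrite ger0_norm; lra.
Qed.

Section Cover.
Variable d : nat.
Implicit Types (z : 'rV[rat]_d) (b : nat -> 'rV[rat]_d * rat).

Definition grid z (S h : rat) (t : seq nat) : 'rV[rat]_d :=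
  \row_i (z 0 i - S + (nth 0%N t i)%:R * h).

(* Every grid point within [S] of [z], up to a margin, must lie well inside one
   of the balls [b j]; the mesh is [h], so each point of the closed ball is
   within [d * h] of some grid point. *)
Definition covered z (S : rat) (L N : nat) (D : pred nat) b : bool :=
  let h := S * 2 / L.+1%:R in
  all_digits d L.+2 (fun t => ~~ near_rat (grid z S h t) z (S + d%:R * h + h) ||
    has (fun j => D j && near_rat (grid z S h t) (b j).1 ((b j).2 - d%:R * h)) (iota 0 N)) [::].

Lemma ratr_mesh (S : rat) L : ratr (S * 2 / L.+1%:R) = ratr S * 2 / L.+1%:R :> R.
Proof. by rewrite fmorph_div /= rmorphM /= !ratr_nat. Qed.

Lemma covered_sound z S L N D b y : 0 < S -> covered z S L N D b ->
  enorm (y - vratr z) <= ratr S ->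
  exists j, [/\ (j < N)%N, D j & eball (vratr (b j).1) (ratr (b j).2) y].
Proof.
move=> S0; rewrite /covered; set h := S * 2 / _ => /all_digitsP cov yz.
have S0' : 0 < ratr S :> R by rewrite ltr0q.
have hE : ratr h = ratr S * 2 / L.+1%:R :> R by exact: ratr_mesh.
have h0 : 0 < ratr h :> R by rewrite hE divr_gt0 ?ltr0n // mulr_gt0.
have dig (i : 'I_d) : exists t, (t < L.+2)%N /\
    `|y 0 i - (ratr (z 0 i) - ratr S) - t%:R * ratr h| <= ratr h.
  have [|t lt_t Ht] := @grid_digit (ratr S) (ratr h) (y 0 i - (ratr (z 0 i) - ratr S)) L S0' hE.
    have := le_trans (coord_le_enorm (y - vratr z) i) yz.
    by rewrite !mxE ler_norml => /andP[h1 h2]; apply/andP; split; lra.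
  by exists t.
have [t Ht] := choice dig; pose s := [seq t i | i <- enum 'I_d].
have := cov s; rewrite cats0 size_map size_enum_ord => /(_ erefl).
have -> : all (fun x => x < L.+2)%N s.
  by apply/allP => _ /mapP[i _ ->]; exact: (Ht i).1.
set g := grid _ _ _ _ => /(_ isT).
have yg : enorm (y - vratr g) <= d%:R * ratr h.
  apply: enorm_le_coord => i; rewrite !mxE (nth_map i) ?size_enum_ord // nth_ord_enum.
  rewrite rmorphD rmorphM rmorphB /= ratr_nat.
  by apply: le_trans (Ht i).2; rewrite le_eqVlt; apply/orP; left; apply/eqP; congr `|_|; ring.
case/orP => [|/hasP[j]].
  (* The grid point is within [S + d * h] of [z]; the additional [h] in the test makes this bound
     strict. *)
  rewrite near_ratE => /negP[]; apply: le_lt_trans (enorm_tri y _ _) _.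
  rewrite enorm_sym !rmorphD rmorphM /= ratr_nat.
  by move: yg yz h0; move: (enorm _) (enorm _) (d%:R * ratr h : R) (ratr S : R) (ratr h : R) => *; lra.
rewrite mem_iota /= add0n => lt_j /andP[Dj].
rewrite near_ratE rmorphB rmorphM /= ratr_nat => gb; exists j; split=> //.
rewrite /eball /=; apply: le_lt_trans (enorm_tri (vratr g) _ _) _.
by move: yg gb; move: (enorm _) (enorm _) (d%:R * ratr h : R) => *; lra.
Qed.

(** The two bounds on the mesh [h] express that every tested grid point, at distance below
    [S + d.+1 * h] from [z], lies in the larger ball around [y0], and that shrinking the covering
    balls by [d * h] costs at most the margin [eps]. *)
Lemma covered_complete z S L N (D : pred nat) b (y0 : 'rV[R]_d) (s eps : R) :
  (forall y, ecball y0 s y -> exists2 j, (j < N)%N &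
     D j /\ enorm (y - vratr (b j).1) + eps < ratr (b j).2) ->
  enorm (vratr z - y0) + ratr S + d.+1%:R * (ratr S * 2 / L.+1%:R) <= s ->
  d%:R * (ratr S * 2 / L.+1%:R) <= eps ->
  covered z S L N D b.
Proof.
move=> leb; rewrite -ratr_mesh /covered; set h := S * 2 / _ => Hs Heps.
apply/all_digitsP => t _ _; rewrite cats0; set g := grid _ _ _ _.
case: (boolP (near_rat g z _)) => //=; rewrite near_ratE !rmorphD rmorphM /= ratr_nat => gz.
have [|j lt_j [Dj Hj]] := leb (vratr g).
  rewrite /ecball /=; apply: le_trans (enorm_tri (vratr z) _ _) _.
  move: gz Hs; rewrite -natr1 mulrDl mul1r.
  by move: (enorm _) (enorm _) (d%:R * ratr h : R) (ratr S : R) (ratr h : R) => *; lra.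
apply/hasP; exists j; first by rewrite mem_iota.
rewrite Dj near_ratE rmorphB rmorphM /= ratr_nat.
by move: Hj Heps; move: (enorm _) (d%:R * ratr h : R) (ratr (b j).2 : R) => *; lra.
Qed.

Lemma cpt_covered n (Z : (nat -> nat) -> seq nat -> 'rV[rat]_d) S L N
  (D : (nat -> nat) -> seq nat -> pred nat) (b : (nat -> nat) -> seq nat -> nat -> nat) :
  cvec n Z -> crat n S -> cpt n L -> cpt n N ->
  cpt n.+1 (fun p a => D p (behead a) (nth 0%N a 0)) ->
  cpt n.+1 (fun p a => b p (behead a) (nth 0%N a 0)) ->
  cpt n (fun p a => covered (Z p a) (S p a) (L p a) (N p a) (D p a) (fun j => decB d (b p a j))).
Proof.
move=> HZ HS HL HN HD Hb.
pose h p a := S p a * 2 / (L p a).+1%:R.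
pose g p a t := grid (Z p a) (S p a) (h p a) t.
have Hh : crat n h.
  apply: crat_mul; last by apply: (@crat_inv _ (fun p a => (L p a).+1)); solve_cpt.
  by apply: crat_mul => //; exact: crat_const.
apply: (@cpt_all_digits n d (fun p a => (L p a).+2) (fun p a t =>
  ~~ near_rat (g p a t) (Z p a) (S p a + d%:R * h p a + h p a) ||
    has (fun j => D p a j && near_rat (g p a t) (decB d (b p a j)).1
      ((decB d (b p a j)).2 - d%:R * h p a)) (iota 0 (N p a)))); last by solve_cpt.
have crat_dropF k Q : crat n Q -> crat (k + n) (fun p a => Q p (drop k a)).
  move=> [A [B [C [HA HB HC E]]]].
  exists (fun p a => A p (drop k a)), (fun p a => B p (drop k a)), (fun p a => C p (drop k a)).
  split; try exact: cpt_dropF.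
  by move=> p a sa; apply: E; rewrite size_drop sa addKn.
have crat_behead k Q : crat k Q -> crat k.+1 (fun p a => Q p (behead a)).
  move=> [A [B [C [HA HB HC E]]]].
  exists (fun p a => A p (behead a)), (fun p a => B p (behead a)), (fun p a => C p (behead a)).
  split; try exact: cpt_behead.
  by move=> p a sa; apply: E; rewrite size_behead sa.
have Hg : cvec (d + n) (fun p a => g p (drop d a) (take d a)).
  move=> i; apply: (@crat_ext _ (fun p a => Z p (drop d a) 0 i - S p (drop d a) +
      (nth 0%N a i)%:R * h p (drop d a))).
    by move=> p a _; rewrite mxE nth_take.
  apply: crat_add.
    by apply: crat_sub; [exact: (crat_dropF _ _ (HZ i))|exact: crat_dropF].
  by apply: crat_mul; [apply: crat_nat; solve_cpt|exact: crat_dropF].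
have Hdh : crat n (fun p a => d%:R * h p a).
  by apply: crat_mul => //; exact: crat_const.
apply: cpt_or.
  apply: cpt_neg; apply: cpt_near => // [i|]; first exact: (crat_dropF _ _ (HZ i)).
  apply: (crat_dropF d (fun p a => S p a + d%:R * h p a + h p a)).
  by do 2?apply: crat_add.
apply: (@cpt_has _ (fun p a j => D p (drop d a) j &&
   near_rat (g p (drop d a) (take d a)) (decB d (b p (drop d a) j)).1
      ((decB d (b p (drop d a) j)).2 - d%:R * h p (drop d a)))); last exact: cpt_dropF.
have under_drop (F : (nat -> nat) -> seq nat -> nat -> nat) :
    cpt n.+1 (fun p a => F p (behead a) (nth 0%N a 0)) ->
    cpt (d + n).+1 (fun p a => F p (drop d (behead a)) (nth 0%N a 0)).
  move=> HF; pose Gs : seq ((nat -> nat) -> seq nat -> nat) :=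
    (fun _ a => nth 0%N a 0) :: [seq (fun _ a => nth 0%N a (d + i).+1) | i <- iota 0 n].
  have HGs : List.Forall (cpt (d + n).+1) Gs.
    constructor; last by apply: Forall_map => i; exact: cpt_nth.
    by solve_cpt.
  have := cpt_comp HF _ HGs; rewrite /= size_map size_iota => /(_ erefl).
  apply: cpt_ext => p [|x a] //= [sa]; congr (F p _ x).
  rewrite -map_comp /comp /= -[RHS](mkseq_nth 0%N) size_drop sa addKn.
  by apply: eq_map => i; rewrite nth_drop.
have Hb' := under_drop b Hb.
apply: cpt_and; first exact: (under_drop D HD).
apply: cpt_near => [i|i|].
- exact: (crat_behead _ _ (Hg i)).
- exact: crat_decB1.
- apply: crat_sub; first exact: crat_decB2.
  exact: (crat_behead _ _ (crat_dropF d _ Hdh)).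
Qed.
End Cover.

(** * Names of the intersections of small balls with [X], and the approximation of [Moo] *)

Section OpenToMoo.
Variables (n m : nat) (X : set 'rV[R]_n).

Section Trace.
Variables (eX : prf) (pX : nat -> nat).
Hypotheses (rX : realizes eX (fun _ => 0%N) pX) (tX : theta_lt pX X).

(* The indices of the name of [B(x, 2^-k) `&` X] code a rational ball, a
   precision for [x], the index of a ball of [X], and the length of a run. *)
Definition Xball (i : nat) : nat :=
  run eX (mkseq (fun _ => 0%N) (cnth i 3)) (cnth i 2).

(** Inclusion of balls is certified by comparing the distance of centres with the difference of
    radii. The first test also gives up the error of the approximation to [x]. *)
Definition trace_ok (r : nat -> nat) (i : nat) : bool :=
  let b := decB n (cnth i 0) in let b' := decB n (Xball i).-1 in
  [&& Xball i != 0%N,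
      near_rat b.1 (decV n (r (2 * cnth i 1)%N)) (e2 (r 1%N) - e2 (cnth i 1) - b.2) &
      near_rat b.1 b'.1 (b'.2 - b.2)].

Definition trace_name (r : nat -> nat) (i : nat) : nat :=
  if trace_ok r i then cnth i 0 else empty_ball n.

Lemma cpt_trace_name k F : cpt k F -> cpt k (fun r a => trace_name r (F r a)).
Proof.
move=> HF; have HX : cpt k (fun r a => Xball (F r a)).
  by apply: cpt_run; solve_cpt; apply: cpt_cseq; solve_cpt.
rewrite /trace_name /trace_ok; solve_cpt; apply: cpt_near => [i|i|].
- by apply: crat_decB1; solve_cpt.
- by apply: crat_decV; solve_cpt.
- apply: crat_sub; last by apply: crat_decB2; solve_cpt.
  by apply: crat_sub; apply: crat_e2; solve_cpt.
- by apply: crat_decB1; solve_cpt.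
- by apply: crat_decB1; solve_cpt.
- by apply: crat_sub; apply: crat_decB2; solve_cpt.
Qed.

Lemma trace_nameP r x k : prod_rep (@rho n) nu r (x, k) ->
  theta_lt (trace_name r) (eball x (2 ^- k) `&` X).
Proof.
move=> /prod_rep_even[rx rk]; apply/seteqP; split=> y; last first.
  move=> [i _]; rewrite /trace_name; case: ifP; last by rewrite eball_empty_ball.
  case/and3P => CX; rewrite !near_ratE !rmorphB /= !ratr_e2 rk.
  have XE := realizes_run_eq rX CX; rewrite /Xball XE => h1 h2 yb; split.
    have h3 := rx (cnth i 1); rewrite /eball /=.
    have := enorm_tri_lt yb (enorm_tri_lt h1 h3); congr (_ < _); ring.
  by rewrite tX; exists (cnth i 2) => //; exact: eball_sub yb.
move=> [yx Xy]; have := Xy; rewrite tX => -[j _]; rewrite /eball /=.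
set c := vratr _; set s := ratr _ => yc; rewrite /eball /= in yx.
(* The room is split in four: [2 ^- h] for the radius and again for the distance from [y] to the
   centre, [2 ^- M] for the error of the approximation to [x] and again for its allowance in the
   test. *)
have [M HM] := @pow2_small ((2 ^- k - enorm (y - x)) / 4) ltac:(by rewrite divr_gt0 // subr_gt0).
have [h Hh] := @pow2_small (Num.min ((2 ^- k - enorm (y - x)) / 4) ((s - enorm (y - c)) / 4))
  ltac:(by rewrite lt_min !divr_gt0 // subr_gt0).
move: Hh; rewrite lt_min => /andP[Hh1 Hh2].
have [z Hz] := rat_dense y (pow2_gt0 h).
have [N /(_ _ (leqnn _)) HN] := realizes_run j rX.
pose i := code [:: pickle (z, e2 h); M; j; N].
have ok : trace_ok r i.
  rewrite /trace_ok /Xball /i !cnth_code /= HN /= decB_pickle /= !near_ratE.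
  rewrite !rmorphB /= !ratr_e2 rk; apply/andP; split.
    have h3 := rx M; rewrite enorm_sym in h3.
    have h4 : enorm (y - x) < 2 ^- k - 2 ^- h - 2 ^- h - 2 ^- M - 2 ^- M.
      by move: HM Hh1; move: (enorm _) (2 ^- k) (2 ^- h) (2 ^- M) => *; lra.
    have := enorm_tri_lt Hz (enorm_tri_lt h4 h3); congr (_ < _); ring.
  have h4 : enorm (y - c) < s - 2 ^- h - 2 ^- h.
    by move: yc Hh2; move: (enorm _) (2 ^- h) => *; lra.
  have := enorm_tri_lt Hz h4; congr (_ < _); rewrite -/c -/s; ring.
exists i => //; rewrite /trace_name ok /i cnth_code /= decB_pickle /= ratr_e2.
by rewrite /eball /= enorm_sym.
Qed.
End Trace.

Lemma eopen_trace x k : re_open X -> eopen (eball x (2 ^- k) `&` X).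
Proof.
move=> [pX [_ tX]] y [yx Xy]; rewrite /eball /= in yx.
move: (Xy); rewrite {1}tX => -[j _]; rewrite /eball /=.
set c := vratr _; set s := ratr _ => yc.
exists (Num.min (2 ^- k - enorm (y - x)) (s - enorm (y - c))).
  by rewrite lt_min !subr_gt0 yx.
move=> z; rewrite /eball /= lt_min => /andP[h1 h2]; split.
  by apply: le_lt_trans (enorm_tri y _ _) _; rewrite -ltrBrDr.
rewrite tX; exists j => //; rewrite /eball /= -/c -/s.
by apply: le_lt_trans (enorm_tri y _ _) _; rewrite -ltrBrDr.
Qed.

Variable f : 'rV[R]_n -> 'rV[R]_m.
Hypotheses (reX : re_open X) (Hf : computable_on X f) (Hopen : eff_open X f).

(** The output name of the image must list a ball containing [f x]; half of the room left in that
    ball is an admissible radius. *)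
Lemma Moo_gt0 x k : X x -> (0 < Moo X f x k)%E.
Proof.
move=> Xx; have [eo Ho] := Hopen; have [pX [[eX rX] tX]] := reX.
have [p rp] := rho_exists x.
have [] := Ho (eball x (2 ^- k) `&` X) _ _ (trace_nameP rX tX (prod_rep_join k rp)).
  by split; [exact: eopen_trace|exact: subIsetr].
move=> q [_ [_ [-> tq]]].
have : (f @` (eball x (2 ^- k) `&` X)) (f x).
  by exists x => //; split=> //; rewrite /eball /= subrr enorm0 pow2_gt0.
rewrite {1}tq => -[j _]; rewrite /eball /=; set c := vratr _; set s := ratr _ => fxc.
pose g := (s - enorm (f x - c)) / 2.
have g0 : 0 < g by rewrite divr_gt0 // subr_gt0.
apply: (@lt_le_trans _ _ g%:E); first by rewrite lte_fin.
apply: ereal_sup_ubound; exists g => //=; split; first exact: ltW.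
rewrite tq => y yb; exists j => //; rewrite /eball /= -/c -/s.
apply: le_lt_trans (enorm_tri (f x) _ _) _; move: yb; rewrite /ecball /= /g.
by move: fxc; move: (enorm _) (enorm _) => *; lra.
Qed.

(* An output index codes the rational radius [s], the precision to which [f x] is
   computed, the run lengths for [f] and for the list of balls, the number of
   balls used, and the grid resolution. *)
Lemma Moo_computable : fun_computable (prod_rep (@rho n) nu) rho_lt [set xk | X (fst xk)]
  (fun xk => Moo X f (fst xk) (snd xk)).
Proof.
have [eo Ho] := Hopen; have [pX [[eX rX] tX]] := reX; have [ef Hef] := Hf.
pose W r := trace_name eX r.
pose V (r : nat -> nat) w := run ef (mkseq (fun i => r (2 * i)%N) (cnth w 2)) (cnth w 1).
pose B r w j := run eo (mkseq (W r) (cnth w 3)) j.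
pose s w := decQ (cnth w 0).
(* As [f x] is known up to [2 ^- M] only, a ball enlarged by this amount around its approximation is
   tested. *)
pose C r w := [&& 0 <= s w, V r w != 0%N &
  covered (decV m (V r w).-1) (s w + e2 (cnth w 1)) (cnth w 5) (cnth w 4)
    (fun j => B r w j != 0%N) (fun j => decB m (B r w j).-1)].
(* Candidates that fail list 0, which is a lower bound because [Moo] is positive. *)
pose O r w := if C r w then cnth w 0 else pickle (0 : rat).
have [|e He] := @realizes_total O.
  have HV : cpt 1 (fun r a => V r (nth 0%N a 0)).
    by apply: cpt_run; solve_cpt; apply: (@cpt_mkseq _ (fun r a i => r (2 * i)%N)); solve_cpt.
  have HB : cpt 2 (fun r a => B r (nth 0%N (behead a) 0) (nth 0%N a 0)).
    apply: cpt_run; solve_cpt; apply: (@cpt_mkseq _ (fun r a i => W r i)); solve_cpt.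
    by apply: cpt_trace_name; solve_cpt.
  rewrite /O; solve_cpt; rewrite /C; solve_cpt.
    by apply: crat_le; [exact: crat_const|apply: crat_decQ; solve_cpt].
  apply: (@cpt_covered m 1 (fun r a => decV m (V r (nth 0%N a 0)).-1)
    (fun r a => s (nth 0%N a 0) + e2 (cnth (nth 0%N a 0) 1))
    (fun r a => cnth (nth 0%N a 0) 5) (fun r a => cnth (nth 0%N a 0) 4)
    (fun r a j => B r (nth 0%N a 0) j != 0%N) (fun r a j => (B r (nth 0%N a 0) j).-1)); solve_cpt.
    by move=> i; apply: crat_decV; solve_cpt.
  by apply: crat_add; [apply: crat_decQ|apply: crat_e2]; solve_cpt.
exists e => -[x k] r /= Xx rxk; exists (O r); split; first exact: He.
exists (Moo X f x k); split=> //.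
have [rx rk] := prod_rep_even rxk.
have [|q [rq [_ [-> tq]]]] := Ho (eball x (2 ^- k) `&` X) _ _ (trace_nameP rX tX rxk).
  by split; [exact: eopen_trace|exact: subIsetr].
have Vok w : V r w != 0%N -> enorm (vratr (decV m (V r w).-1) - f x) < 2 ^- cnth w 1.
  by move=> /run_some; apply: (ev_val Hef Xx); apply: rho_prefix.
apply/eqP; rewrite eq_le; apply/andP; split.
  apply: ge_ereal_sup => _ [w _ <-]; rewrite /O; case: ifP => [|_]; last first.
    by rewrite decQ_pickle rmorph0; apply: ltW; exact: Moo_gt0.
  case/and3P => s0 CV cov; apply: ereal_sup_ubound; exists (ratr (s w)) => //=.
  split; first by rewrite ler0q.
  move=> y ys; rewrite tq.
  have [||j [_ Dj yj]] := covered_sound (y := y) _ cov.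
  - by rewrite ltr_wpDl // /e2 invr_gt0 exprn_gt0.
  - rewrite rmorphD /= ratr_e2; have := Vok w CV; rewrite enorm_sym => h.
    by apply: le_trans (enorm_tri (f x) _ _) (lerD ys (ltW h)).
  by exists j => //; rewrite -(realizes_run_eq rq Dj).
apply: ge_ereal_sup => _ [s1 [s10 sub] <-].
apply/lee_addgt0Pr => eps e0.
set S := ereal_sup _.
have inS w : ((ratr (decQ (O r w)))%:E <= S)%E by apply: ereal_sup_ubound; exists w.
have [s1_le0|s1_gt0] := leP s1 0.
  have : (0 <= S)%E.
    apply: le_trans (inS 0%N); rewrite lee_fin ler0q /O.
    by case: ifP => [/and3P[]//|_]; rewrite decQ_pickle.
  move=> S0; apply: le_trans (leeD S0 (lexx eps%:E)).
  by rewrite add0e lee_fin; apply: le_trans s1_le0 (ltW e0).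
(* The gap between [q1] and [s1] has to pay for the error in [f x] and for the mesh. *)
have [q1] := @rat_in_itvoo R (Num.max 0 (s1 - eps)) s1 ltac:(by rewrite gt_max s1_gt0 gtrBl).
rewrite in_itv /= gt_max => /andP[/andP[q10 q1e] q1s].
apply: (@le_trans _ _ ((ratr q1)%:E + eps%:E)%E).
  by rewrite -EFinD lee_fin; lra.
apply: leeD => //.
have cover : ecball (f x) s1 `<=`
    \bigcup_(j in [set: nat]) eball (vratr (decB m (q j)).1) (ratr (decB m (q j)).2).
  by rewrite -tq.
have [N [eta [eta0 leb]]] := lebesgue_number cover.
have [M HM] := @pow2_small ((s1 - ratr q1) / 4) ltac:(by rewrite divr_gt0 // subr_gt0).
have [N1 /(_ _ (leqnn _))[v Ev]] := ev_conv Hef M Xx rx.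
have [N2 /(_ _ (leqnn _)) HN2] := realizes_run_all N rq.
(* [T / L.+1] is [m.+1] times the mesh. Keeping it below [gam] makes the mesh cost at most a quarter
   of the gap and at most the margin [eta]; the error in [f x] takes two more quarters. *)
pose T : R := (ratr q1 + 2 ^- M) * 2 * m.+1%:R; pose gam := Num.min ((s1 - ratr q1) / 4) eta.
have gam0 : 0 < gam by rewrite lt_min eta0 andbT divr_gt0 // subr_gt0.
have M0 := pow2_gt0 M.
have T0 : 0 < T by rewrite !mulr_gt0 ?ltr0n // ltr_wpDl // ltW.
pose L := Num.bound (T / gam).
have HL : T / L.+1%:R <= gam.
  have := archi_boundP (ltW (divr_gt0 T0 gam0)); rewrite -/L => hL.
  rewrite ler_pdivrMr ?ltr0n // mulrC -ler_pdivrMr //; apply: ltW; apply: lt_trans hL _.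
  by rewrite ltr_nat.
pose w := code [:: pickle q1; M; N1; N2; N; L].
have VE : V r w = v.+1 by rewrite /V /run /w !cnth_code /= Ev.
have vf : enorm (vratr (decV m v) - f x) < 2 ^- M.
  by apply: (ev_val Hef Xx _ Ev); exact: rho_prefix.
have sE : s w = q1 by rewrite /s /w cnth_code /= decQ_pickle.
suff Cw : C r w.
  by have := inS w; rewrite /O Cw /w cnth_code /= decQ_pickle.
have BE j : (j < N)%N -> B r w j = (q j).+1.
  by move=> lt_j; rewrite /B /w cnth_code HN2.
have [w1 w4 w5] : [/\ cnth w 1 = M, cnth w 4 = N & cnth w 5 = L].
  by rewrite /w !cnth_code.
rewrite /C sE VE w1 w4 w5; apply/andP; split.
  by rewrite -(ler0q R) ltW.
have TE : T / L.+1%:R = m.+1%:R * (ratr (q1 + e2 M) * 2 / L.+1%:R).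
  by rewrite rmorphD /= ratr_e2 /T mulrC mulrA [_^-1 * _]mulrC; ring.
apply: (@covered_complete _ _ _ _ N _ _ (f x) s1 eta) => [y Ky||].
- have [j lt_j Hj] := leb y Ky; exists j => //.
  by rewrite BE.
- rewrite -TE rmorphD /= ratr_e2.
  have gamle : gam <= (s1 - ratr q1) / 4 by rewrite /gam ge_min lexx.
  have := le_trans HL gamle.
  by move: q1s vf HM; move: (enorm _) (ratr q1 : R) (2 ^- M) (T / _) => *; lra.
- apply: le_trans (_ : T / L.+1%:R <= _); last by apply: le_trans HL _; rewrite ge_min lexx orbT.
  rewrite TE ler_wpM2r ?ler_nat // divr_ge0 ?ler0n // mulr_ge0 // rmorphD /= ratr_e2.
  by rewrite addr_ge0 // ltW.
Qed.
End OpenToMoo.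

Theorem theorem2 (n m : nat) (X : set 'rV[R]_n) (hX : re_open X) :
  (* (a ii) *)
  (forall xs : nat -> 'rV[R]_n, computable_seq xs -> dense_seq_in xs X ->
    forall f : 'rV[R]_n -> 'rV[R]_m,
      computable_on X f <->
      (computable_seq (fun j => f (xs j)) /\
       exists moc : 'rV[R]_n * nat -> nat -> Prop,
         mv_computable (prod_rep (@rho n) nu) nu [set xk | X (fst xk)] moc /\
         (forall (x : 'rV[R]_n) (k l : nat), X x -> moc (x, k) l ->
            f @` (eball x (2 ^- l) `&` X) `<=` eball (f x) (2 ^- k))))
  /\
  (* (b i) *)
  (forall f : 'rV[R]_n -> 'rV[R]_m, computable_on X f ->
     (eff_open X f <->
      ((forall (x : 'rV[R]_n) (k : nat), X x -> (0 < Moo X f x k)%E) /\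
       fun_computable (prod_rep (@rho n) nu) rho_lt [set xk | X (fst xk)]
         (fun xk => Moo X f (fst xk) (snd xk)))))
  /\
  (* (b ii) *)
  (forall f : 'rV[R]_n -> 'rV[R]_m, computable_on X f ->
     (eff_open X f <->
      exists moo : 'rV[R]_n * nat -> nat -> Prop,
        mv_computable (prod_rep (@rho n) nu) nu [set xk | X (fst xk)] moo /\
        (forall (x : 'rV[R]_n) (k l : nat), X x -> moo (x, k) l ->
           eball (f x) (2 ^- l) `<=` f @` (eball x (2 ^- k) `&` X)))).
Proof.
split; [|split] => [xs cxs dxs f|f Hf|f Hf].
- split=> [Hf|[Hs [moc [Hm moc_sound]]]]; last exact: (computable_of_moc cxs dxs Hs Hm moc_sound).
  split; first exact: (computable_seq_image Hf cxs (proj1 dxs)).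
  (* The modulus is taken to be the relation satisfied by every valid [l], so its soundness is
     immediate. *)
  by eexists; split; [exact: computable_moc Hf|move=> x k l _; exact].
- split=> [Ho|[M0 HM]].
    by split; [move=> x k; exact: Moo_gt0|exact: Moo_computable].
  by apply: (eff_open_of_moo _ Hf (moo_of_Moo M0 HM)) => x k l _; exact.
- split=> [Ho|[moo [Hm sound]]]; last exact: (eff_open_of_moo sound Hf Hm).
  have M0 x k := Moo_gt0 hX Ho k (x := x).
  by eexists; split; [exact: moo_of_Moo M0 (Moo_computable hX Hf Ho)|move=> x k l _; exact].
Qed.
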